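(* Let $X$ be a proper Gromov-hyperbolic space with compact boundary, and let $\Gamma$ be a discrete, torsion-free group of isometries of $X$ that does not fix any point of the boundary $\partial X$. Then $$\sup_{\Gamma'}\delta_{\Gamma'}\ge\frac12\,\delta_\Gamma ,$$ where the supremum is taken over all subgroups $\Gamma'$ of $\Gamma$ that are Schottky groups.
   Context: Let $X$ be a metric space with base point $o$. The Gromov product is $(x|y)=\frac12(d(x,o)+d(y,o)-d(x,y))$. $X$ is $\delta$-hyperbolic if $(x|z)\ge\min\{(x|y),(y|z)\}-\delta$ for all $x,y,z\in X$, and Gromov-hyperbolic if it is $\delta$-hyperbolic for some $\delta\ge0$ ($X$ is not assumed geodesic). $X$ is proper if its closed balls are compact. Discreteness of $\Gamma$ is as a subgroup of $\mathrm{Isom}(X)$ with the compact-open topology. Boundary: a sequence $(x_i)$ in $X$ is convergent if $\lim_{i,j\to\infty}(x_i|x_j)=\infty$; $\partial X$ is the set of convergent sequences modulo $(x_i)\sim(y_j)$ iff $\lim_{i,j\to\infty}(x_i|y_j)=\infty$, and $\mathrm{Isom}(X)$ acts naturally on it. The Gromov product extends to $\overline X=X\cup\partial X$ by $(\xi|\eta)=\sup_{x_i\to\xi,\,y_j\to\eta}\liminf_{i,j\to\infty}(x_i|y_j)$, and $\overline X$ has the topology with neighbourhood basis given by the open balls of $X$ and the sets $\{x\in\overline X:(x|\xi)>-\log r\}$, $\xi\in\partial X$. The critical exponent of a subset $A\subseteq\mathrm{Isom}(X)$ is $\delta_A=\limsup_{n\to\infty}\frac1n\log\#(B(o,n)\cap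 Ao)$. Two subsets $A,B$ of $X$ are Gromov-disjoint if their closures in $X$ are disjoint and $\sup_{(a,b)\in A\times B}(a|b)<C$ for some constant $C>0$. Schottky group: the group generated by a finite set $G$ of isometries of $X$ for which there exist subsets $X_\gamma^+,X_\gamma^-\subseteq X$ ($\gamma\in G$), all pairwise Gromov-disjoint, such that $\gamma(X\setminus X_\gamma^-)\subseteq X_\gamma^+$ for every $\gamma\in G$ and $X\setminus\bigcup_{\gamma\in G}(X_\gamma^+\cup X_\gamma^-)$ has non-empty interior. *)

(* Defs.v *)
From HB Require Import structures.
From mathcomp Require Import all_boot all_order all_algebra lra.
From mathcomp Require Import all_classical all_reals all_analysis.

Set Implicit Arguments.
Unset Strict Implicit.
Unset Printing Implicit Defensive.

Import Order.TTheory GRing.Theory Num.Theory.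
Import numFieldNormedType.Exports.

Local Open Scope classical_set_scope.
Local Open Scope ring_scope.

Definition proper_metric (R : realType) (X : metricType R) : Prop :=
  forall (x : X) (r : R), compact [set y : X | mdist x y <= r].

(* Surjectivity is witnessed by the inverse map, which is determined by the
   underlying map. *)
Record misom (R : realType) (X : metricType R) := MIsom {
  misom_fun :> X -> X;
  misom_inv : X -> X;
  misom_funK : cancel misom_fun misom_inv;
  misom_invK : cancel misom_inv misom_fun;
  misom_mdist : forall x y, mdist (misom_fun x) (misom_fun y) = mdist x y }.

Section Isometries.
Context (R : realType) (X : metricType R).
Implicit Types g h k : misom X.

Lemma misomP g h : g =1 h -> g = h.
Proof.
case: g h => [f f' fK f'K df] [e e' eK e'K de] /= /funext fe.
have fe' : f' = e' by apply/funext => x; rewrite -[x in LHS]e'K -fe fK.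
move: fK f'K df eK e'K de; rewrite {}fe {}fe' => fK f'K df eK e'K de.
by congr MIsom; apply: Prop_irrelevance.
Qed.

Definition misom_one : misom X :=
  @MIsom R X id id (fun=> erefl) (fun=> erefl) (fun _ _ => erefl).

Lemma misom_opp_mdist g x y : mdist (misom_inv g x) (misom_inv g y) = mdist x y.
Proof. by rewrite -(misom_mdist g) !misom_invK. Qed.

Definition misom_opp g : misom X :=
  MIsom (@misom_invK _ _ g) (@misom_funK _ _ g) (misom_opp_mdist g).

Lemma misom_mul_mdist g h x y : mdist (g (h x)) (g (h y)) = mdist x y.
Proof. by rewrite !misom_mdist. Qed.

Definition misom_mul g h : misom X :=
  @MIsom R X (g \o h) (misom_inv h \o misom_inv g)
    (can_comp (@misom_funK _ _ g) (@misom_funK _ _ h))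
    (can_comp (@misom_invK _ _ h) (@misom_invK _ _ g))
    (misom_mul_mdist g h).

Lemma misom_mulA : associative misom_mul.
Proof. by move=> g h k; apply: misomP. Qed.
Lemma misom_mul1 : left_id misom_one misom_mul.
Proof. by move=> g; apply: misomP. Qed.
Lemma misom_mulr1 : right_id misom_one misom_mul.
Proof. by move=> g; apply: misomP. Qed.
Lemma misom_mulV : left_inverse misom_one misom_opp misom_mul.
Proof. by move=> g; apply: misomP => x /=; rewrite misom_funK. Qed.
Lemma misom_mulrV : right_inverse misom_one misom_opp misom_mul.
Proof. by move=> g; apply: misomP => x /=; rewrite misom_invK. Qed.

HB.instance Definition _ := gen_eqMixin (misom X).
HB.instance Definition _ := gen_choiceMixin (misom X).
HB.instance Definition _ := isGroup.Build (misom X)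
  misom_mulA misom_mul1 misom_mulr1 misom_mulV misom_mulrV.
HB.instance Definition _ := Topological.copy (misom X)
  (@initial_topology (misom X) {compact-open, X -> X} (@misom_fun R X)).

End Isometries.

Section Groups.
Context (G : groupType).
Implicit Types (A H : set G).

Definition is_subgroup H : Prop := group_closed (mem H).

Definition subgroup_gen A : set G := smallest is_subgroup A.

Definition torsion_free H : Prop :=
  forall (g : G) (n : nat), H g -> (0 < n)%N -> (g ^+ n = 1)%g -> g = 1%g.

End Groups.

Definition discrete_subset (T : topologicalType) (A : set T) : Prop :=
  A `<=` isolated A.

Section Gromov.
Context (R : realType) (X : metricType R) (o : X).

Definition gprod (x y : X) : R := (mdist x o + mdist y o - mdist x y) / 2.

Definition hyperbolic (delta : R) : Prop := forall x y z : X,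
  Num.min (gprod x y) (gprod y z) - delta <= gprod x z.

Definition gromov_hyperbolic : Prop :=
  exists2 delta : R, 0 <= delta & hyperbolic delta.

Definition gequiv (x y : nat -> X) : Prop :=
  gprod (x ij.1) (y ij.2) @[ij --> filter_prod \oo \oo] --> +oo.

Definition gconvergent (x : nat -> X) : Prop := gequiv x x.

(* A boundary point is the set of all sequences of an equivalence class. *)
Definition gclass (x : nat -> X) : set (nat -> X) :=
  [set y | gconvergent y /\ gequiv x y].

Record gboundary := GBoundary {
  gboundary_set :> set (nat -> X);
  gboundaryP : exists2 x, gconvergent x & gboundary_set = gclass x }.

Lemma gboundary_inj (xi eta : gboundary) :
  xi = eta :> set (nat -> X) -> xi = eta.
Proof.
case: xi eta => [C PC] [D PD] /= CD; rewrite {}CD in PC *.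
by congr GBoundary; apply: Prop_irrelevance.
Qed.

Lemma gprod_isom_ge (g : misom X) x y :
  gprod x y - mdist o (g o) <= gprod (g x) (g y).
Proof.
have le z : mdist z o - mdist o (g o) <= mdist (g z) o.
  rewrite lerBlDr -(misom_mdist g z o).
  exact: metric_triangle.
rewrite /gprod misom_mdist; have := le x; have := le y; lra.
Qed.

Lemma gequiv_isom (g : misom X) x y : gequiv x y -> gequiv (g \o x) (g \o y).
Proof.
move=> /cvgryPge xy; apply/cvgryPge => A.
have := xy (A + mdist o (g o)); apply: filterS => ij /=.
by rewrite -lerBrDr => /le_trans; apply; apply: gprod_isom_ge.
Qed.

Lemma gclass_isom (g : misom X) x :
  [set g \o y | y in gclass x] = gclass (g \o x).
Proof.
apply/seteqP; split => [_ [y [cy xy] <-]|y [cy xy]].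
  by split; apply: gequiv_isom.
have gVK (z : nat -> X) : (g^-1)%g \o (g \o z) = z.
  by apply/funext => n /=; rewrite misom_funK.
exists ((g^-1)%g \o y); last by apply/funext => n /=; rewrite misom_invK.
split; first exact: gequiv_isom.
by rewrite -[x]gVK; apply: gequiv_isom.
Qed.

Lemma gboundary_act_subproof (g : misom X) (xi : gboundary) :
  exists2 x, gconvergent x & [set g \o y | y in xi] = gclass x.
Proof.
case: (gboundaryP xi) => x cx ->; exists (g \o x); first exact: gequiv_isom.
exact: gclass_isom.
Qed.

Definition gboundary_act (g : misom X) (xi : gboundary) : gboundary :=
  GBoundary (gboundary_act_subproof g xi).

Definition fixes_boundary_point (Gamma : set (misom X)) : Prop :=
  exists xi : gboundary,
    forall g : misom X, Gamma g -> gboundary_act g xi = xi.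

Definition gbord : Type := (X + gboundary)%type.

(* Convergence of a sequence of points of X to a point of the bordification:
   in the metric of X towards a point of X; towards a boundary point, it means
   that the sequence represents this boundary point. *)
Definition gcvg_to (x : nat -> X) (a : gbord) : Prop :=
  match a with
  | inl p => x @ \oo --> p
  | inr xi => gboundary_set xi x
  end.

Definition gprodbar (a b : gbord) : \bar R :=
  ereal_sup [set limf_einf
                   (fun ij : nat * nat => (gprod (xy.1 ij.1) (xy.2 ij.2))%:E)
                   (filter_prod \oo \oo)
            | xy in [set xy : (nat -> X) * (nat -> X) |
                     gcvg_to xy.1 a /\ gcvg_to xy.2 b]].

Definition gbord_nbhd (xi : gboundary) (r : R) : set gbord :=
  [set a | ((- ln r)%:E < gprodbar a (inr xi))%E].

(* U is open iff it contains a basic neighbourhood of each of its points: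
   the basic neighbourhoods of x in X are the balls centred at x, those of a
   boundary point xi are the sets gbord_nbhd xi r with r > 0. *)
Definition gbord_open (U : set gbord) : Prop :=
  (forall x : X, U (inl x) ->
     exists2 r : R, 0 < r & [set inl y | y in ball x r] `<=` U) /\
  (forall xi : gboundary, U (inr xi) ->
     exists2 r : R, 0 < r & gbord_nbhd xi r `<=` U).

Lemma gbord_nbhdS xi (r s : R) : 0 < r -> r <= s ->
  gbord_nbhd xi r `<=` gbord_nbhd xi s.
Proof.
move=> r0 rs a; apply: le_lt_trans.
by rewrite lee_fin lerN2 ler_ln ?posrE// (lt_le_trans r0).
Qed.

Lemma gbord_openT : gbord_open setT.
Proof. by split => a _; exists 1. Qed.

Lemma gbord_openI : setI_closed gbord_open.
Proof.
move=> U V [UX UB] [VX VB]; split => [x [/UX[r r0 rU] /VX[s s0 sV]]|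
                                      xi [/UB[r r0 rU] /VB[s s0 sV]]].
- exists (Num.min r s); first by rewrite lt_min r0 s0.
  move=> _ [y yx <-]; split; [apply: rU|apply: sV];
    by exists y => //; apply: le_ball yx; rewrite ge_min lexx ?orbT.
- have m0 : 0 < Num.min r s by rewrite lt_min r0 s0.
  exists (Num.min r s) => // a am; split; [apply: rU|apply: sV];
    by apply: gbord_nbhdS am => //; rewrite ge_min lexx ?orbT.
Qed.

Lemma gbord_open_bigU (I : Type) (f : I -> set gbord) :
  (forall i, gbord_open (f i)) -> gbord_open (\bigcup_i f i).
Proof.
move=> fo; split => a [i _ fa].
- have [r r0 rf] := (fo i).1 a fa.
  by exists r => // b /rf fb; exists i.
- have [r r0 rf] := (fo i).2 a fa.
  by exists r => // b /rf fb; exists i.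
Qed.

HB.instance Definition _ := gen_eqMixin gbord.
HB.instance Definition _ := gen_choiceMixin gbord.
HB.instance Definition _ := isOpenTopological.Build gbord
  gbord_openT gbord_openI gbord_open_bigU.

Definition compact_boundary : Prop :=
  compact (range (inr : gboundary -> gbord)).

(* Cardinality and logarithm are extended-real valued, with ln 0 = -oo. *)
Definition critical_exponent (A : set (misom X)) : \bar R :=
  limn_esup (fun n : nat =>
    ((n%:R^-1)%:E *
     lne (counting (ball o n%:R `&` [set g o | g in A])))%E).

Definition gromov_disjoint (A B : set X) : Prop :=
  [disjoint closure A & closure B] /\
  exists2 C : R, 0 < C &
    (ereal_sup [set (gprod a.1 a.2)%:E | a in A `*` B] < C%:E)%E.

(* Y g true and Y g false are the sets X_g^+ and X_g^-; the family is indexed by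
   the pairs (g, s) with g in G. *)
Definition schottky (H : set (misom X)) : Prop :=
  exists (G : set (misom X)) (Y : misom X -> bool -> set X),
    [/\ finite_set G /\ H = subgroup_gen G,
        forall (g h : misom X) (s t : bool), G g -> G h -> (g, s) <> (h, t) ->
          gromov_disjoint (Y g s) (Y h t),
        forall g : misom X, G g -> [set g x | x in ~` Y g false] `<=` Y g true
      & (~` \bigcup_(g in G) (Y g true `|` Y g false))^° !=set0].

End Gromov.

(* Main.v *)
Require Import Defs.
From mathcomp Require Import all_boot all_order all_algebra lra.
From mathcomp Require Import all_classical all_reals all_analysis.

Set Implicit Arguments.
Unset Strict Implicit.
Unset Printing Implicit Defensive.

Import Order.TTheory GRing.Theory Num.Theory.
Import numFieldNormedType.Exports.

Local Open Scope classical_set_scope.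
Local Open Scope ring_scope.

(** Write |g| for the displacement d(g o, o) and S_n for the elements g of
Gamma with n <= |g| < n + 1.

The factor 1/2 is the price of conjugation.  Fix a loxodromic h whose
ping-pong sets {x : (x|h o) >= |h|/2} and {x : (x|h^-1 o) >= |h|/2} lie far
from g^-1 o as seen from o.  Then g carries both of them into the shadow of
g o, the region where (x|g o) >= |g| - const, so that the conjugate g h g^-1
plays ping-pong inside this shadow.  If g ranges over a separated subset of
S_m, the shadows are far apart and all the conjugates together generate a
Schottky group; see schottky_of_separated.  The conjugates displace o by at
most 2m + const, and their positive words of length k have pairwise distinct
orbit points.  Since a separated subset of S_m has, up to a constant factor,
as many elements as S_m, and S_m is large for suitable m, the exponents come as
close as desired to half of that of Gamma.  The trivial group is a Schottky
group of exponent at least 0, so the exponent of Gamma may be assumed positive,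
and the orbit of o unbounded.

One h does not serve every g, but a pair h_1, h_2 without common endpoints
does: g^-1 o cannot be close to both axes (exists_transverse_pair).  The pair
is obtained in three steps.
- If no element of Gamma were loxodromic, any two orbit points would have
  Gromov product at least min(|g|,|h|)/2 - const, hence every sequence of
  orbit points going to infinity would converge to one and the same boundary
  point, which Gamma would fix (exists_loxodromic).
- For h loxodromic with endpoints xi^+ and xi^-, choose g in Gamma with
  g xi^+ <> xi^+.  If g maps no endpoint to an endpoint, then h^n and
  g h^n g^-1 with n large are the desired pair.
- Otherwise a ray of h and a ray of g h g^-1 fellow-travel, and finiteness
  of balls in Gamma gives g^-1 h^p g = h^p or h^-p for some p > 0
  (rays_commensurable).  In the first case g fixes xi^+; in the second, g^2
  commutes with h^p, so the powers of g^2 stay close to the axis of h, some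
  power of g^2 is a power of h, and g is a torsion element
  (no_axis_reversal).

All of this is carried out with Gromov products of orbit points; the boundary
enters only through sequences representing its points. *)

(** * Displacements and Gromov products of isometries *)

Section GromovProduct.
Context (R : realType) (X : metricType R) (o : X).
Implicit Types (x y z : X) (g h k : misom X).

Definition displ g : R := mdist (g o) o.

Lemma misomM g h x : (g * h)%g x = g (h x). Proof. by []. Qed.
Lemma misomVK g x : g (g^-1%g x) = x. Proof. exact: misom_invK. Qed.
Lemma misomKV g x : g^-1%g (g x) = x. Proof. exact: misom_funK. Qed.

Lemma mdistVl g x y : mdist (g^-1%g x) y = mdist x (g y).
Proof. by rewrite -(misom_mdist g) misomVK. Qed.

Lemma displ_ge0 g : 0 <= displ g. Proof. exact: mdist_ge0. Qed.

Lemma displ1 : displ 1%g = 0. Proof. exact: mdistxx. Qed.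

Lemma displV g : displ g^-1%g = displ g.
Proof. by rewrite /displ mdistVl metric_sym. Qed.

Lemma displM_le g h : displ (g * h)%g <= displ g + displ h.
Proof.
rewrite addrC /displ misomM -(misom_mdist g (h o)); exact: metric_triangle.
Qed.

Lemma displ_prod g h : mdist (g o) (h o) = displ (g^-1 * h)%g.
Proof. by rewrite /displ misomM mdistVl metric_sym. Qed.

Lemma gprodC x y : gprod o x y = gprod o y x.
Proof. by rewrite /gprod (metric_sym x y); lra. Qed.

Lemma gprod_ge0 x y : 0 <= gprod o x y.
Proof.
rewrite /gprod; have := metric_triangle x o y; rewrite (metric_sym o y); lra.
Qed.

Lemma gprod_lel x y : gprod o x y <= mdist x o.
Proof.
rewrite /gprod; have := metric_triangle y x o; rewrite (metric_sym y x); lra.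
Qed.

Lemma gprod_ler x y : gprod o x y <= mdist y o.
Proof. by rewrite gprodC gprod_lel. Qed.

Lemma gprodxx x : gprod o x x = mdist x o.
Proof. by rewrite /gprod mdistxx; lra. Qed.

Lemma gprod0l x : gprod o o x = 0.
Proof. by rewrite /gprod mdistxx (metric_sym o x); lra. Qed.

Lemma mdist_gprod x y : mdist x y = mdist x o + mdist y o - 2 * gprod o x y.
Proof. by rewrite /gprod; lra. Qed.

Lemma gprod_lip x y z : gprod o x z <= gprod o y z + mdist x y.
Proof.
rewrite /gprod; have := metric_triangle x y o; have := metric_triangle y x z.
rewrite (metric_sym y x); lra.
Qed.

(** Pushing by g turns products seen from g^-1 o into products seen from o;
this identity is exact, and is the source of every ping-pong inclusion below. *)
Lemma gprod_actl g x :
  gprod o (g x) (g o) = displ g - gprod o x (g^-1%g o).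
Proof.
rewrite /gprod misom_mdist -/(displ g) -/(displ g^-1%g) displV.
have -> : mdist x (g^-1%g o) = mdist (g x) o.
  by rewrite metric_sym mdistVl metric_sym.
lra.
Qed.

Lemma displM g h :
  displ (g * h)%g = displ g + displ h - 2 * gprod o (g^-1%g o) (h o).
Proof.
by rewrite -[in LHS](invgK g) -displ_prod mdist_gprod -!/(displ _) displV.
Qed.

Lemma gprod_act_le g x y : gprod o (g x) (g y) <= gprod o x y + displ g.
Proof.
have := gprod_isom_ge o g^-1%g (g x) (g y); rewrite !misomKV.
by rewrite (metric_sym o) -/(displ _) displV; lra.
Qed.

Context (delta : R) (hyp : hyperbolic o delta).

Lemma gprod_trans y x z a :
  a <= gprod o x y -> a <= gprod o y z -> a - delta <= gprod o x z.
Proof.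
move=> xy yz; apply: le_trans (hyp x y z).
by rewrite lerD2r le_min xy yz.
Qed.

Lemma gprod_trans3 x y z w a :
  a <= gprod o x y -> a <= gprod o y z -> a <= gprod o z w -> 0 <= delta ->
  a - 2 * delta <= gprod o x w.
Proof.
move=> xy yz zw d0; have xz := gprod_trans xy yz.
by have := @gprod_trans z x w (a - delta) xz ltac:(lra); lra.
Qed.

End GromovProduct.

(** * Loxodromic elements from the absence of fixed boundary points *)

Section Subgroups.
Context (G : groupType) (H : set G) (sgH : is_subgroup H).

Lemma subgroup1 : H 1%g.
Proof. by case: sgH; rewrite !inE. Qed.

Lemma subgroupV g : H g -> H g^-1%g.
Proof.
move=> Hg; have := @group_closedV _ (mem H) sgH g.
by rewrite !inE; apply.
Qed.

Lemma subgroupM g h : H g -> H h -> H (g * h)%g.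
Proof.
move=> Hg Hh; have := @group_closedM _ (mem H) sgH g h.
by rewrite !inE; apply.
Qed.

Lemma subgroupX g n : H g -> H (g ^+ n)%g.
Proof.
move=> Hg; elim: n => [|n IHn]; first exact: subgroup1.
by rewrite expgS; apply: subgroupM.
Qed.

End Subgroups.

Section Boundary.
Context (R : realType) (X : metricType R) (o : X).
Implicit Types (x y z : nat -> X).

Lemma gequivP x y : gequiv o x y <->
  forall a, exists N, forall i j, (N <= i)%N -> (N <= j)%N ->
    a <= gprod o (x i) (y j).
Proof.
split=> [/cvgryPge xy a|xy].
  have [[A B] /= [[N _ NA] [M _ MB]] AB] := xy a.
  exists (maxn N M) => i j; rewrite !geq_max => /andP[Ni _] /andP[_ Mj].
  by apply: (AB (i, j)); split; [exact: NA|exact: MB].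
apply/cvgryPge => a; have [N Nxy] := xy a.
exists ([set i | (N <= i)%N], [set i | (N <= i)%N]) => /=.
  by split; exists N.
by move=> [i j] [/= Ni Nj]; exact: Nxy.
Qed.

Lemma gequiv_sym x y : gequiv o x y -> gequiv o y x.
Proof.
move=> /gequivP xy; apply/gequivP => a; have [N Nxy] := xy a.
by exists N => i j Ni Nj; rewrite gprodC Nxy.
Qed.

Context (delta : R) (hyp : hyperbolic o delta).

Lemma gequiv_trans y x z : gequiv o x y -> gequiv o y z -> gequiv o x z.
Proof.
move=> /gequivP xy /gequivP yz; apply/gequivP => a.
have [N Nxy] := xy (a + delta); have [M Myz] := yz (a + delta).
exists (maxn N M) => i j; rewrite !geq_max => /andP[Ni Mi] /andP[Nj Mj].
have := gprod_trans hyp (Nxy _ _ Ni Nj) (Myz _ _ Mj Mj); lra.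
Qed.

Lemma fixes_gclass (Gamma : set (misom X)) x : gconvergent o x ->
  (forall g, Gamma g -> gequiv o (g \o x) x) -> fixes_boundary_point o Gamma.
Proof.
move=> cx gx; have Px : exists2 y, gconvergent o y & gclass o x = gclass o y.
  by exists x.
exists (GBoundary Px) => g /gx gxx; apply: gboundary_inj => /=.
rewrite gclass_isom; apply/seteqP; split=> y [cy xy]; split=> //.
  by apply: gequiv_trans xy; exact: gequiv_sym.
exact: gequiv_trans xy.
Qed.

Context (delta0 : 0 <= delta) (Gamma : set (misom X)).
Context (sgG : is_subgroup Gamma).

(** Put t = (g^-1 o|h o) and suppose that t is small.  The points g h o and
h^-1 g^-1 o are then close to g o and to h^-1 o, up to products |g| - t and
|h| - t.  As g, h and g h are not loxodromic, each of them has its forward and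
backward orbit points close to each other; the chain g^-1 o, g o, h^-1 o, h o
then makes t large. *)
Lemma gprod_no_loxodromic (c : R) : 0 <= c ->
  (forall h, Gamma h -> displ o h / 2 - c <= gprod o (h o) (h^-1%g o)) ->
  forall g h m, Gamma g -> Gamma h -> m <= displ o g -> m <= displ o h ->
    m / 2 - (c + 2 * delta) <= gprod o (g o) (h o).
Proof.
move=> c0 nolox g' h m Gg' Gh; rewrite -displV -[in gprod _ _ _](invgK g').
have: Gamma g'^-1%g by exact: subgroupV.
move: (g'^-1%g) => g {Gg' g'} Gg mg mh.
set t := gprod o (g^-1%g o) (h o).
rewrite leNgt; apply/negP => tm.
have dgh : displ o (g * h)%g = displ o g + displ o h - 2 * t by exact: displM.
have e1 : gprod o (g (h o)) (g o) = displ o g - t.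
  by rewrite gprod_actl gprodC.
have e2 : gprod o (h^-1%g (g^-1%g o)) (h^-1%g o) = displ o h - t.
  by rewrite gprod_actl displV invgK.
have e3 : displ o (g * h)%g / 2 - c <=
    gprod o (g (h o)) (h^-1%g (g^-1%g o)).
  by have := nolox _ (subgroupM sgG Gg Gh); rewrite invgM !misomM.
have e4 : m - t - c - 2 * delta <= gprod o (g o) (h^-1%g o).
  apply: (gprod_trans3 hyp (y := g (h o)) (z := h^-1%g (g^-1%g o))) => //.
  - by rewrite gprodC e1; lra.
  - by lra.
  - by rewrite e2; lra.
have e5 : m / 2 - c - 2 * delta <= t.
  apply: (gprod_trans3 hyp (y := g o) (z := h^-1%g o)) => //.
  - by rewrite gprodC; have := nolox _ Gg; lra.
  - by lra.
  - by rewrite gprodC; have := nolox _ Gh; lra.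
lra.
Qed.

(** Without loxodromic elements, a sequence of orbit points going to infinity
is convergent, and equivalent to each of its translates, by the previous
bound. *)
Lemma exists_loxodromic (c : R) : 0 <= c ->
  ~ fixes_boundary_point o Gamma ->
  (forall B, exists2 g, Gamma g & B < displ o g) ->
  exists2 h, Gamma h & gprod o (h o) (h^-1%g o) < displ o h / 2 - c.
Proof.
move=> c0 nofix unbdd; apply: contrapT => nolox; apply: nofix.
have {}nolox h : Gamma h -> displ o h / 2 - c <= gprod o (h o) (h^-1%g o).
  by move=> Gh; rewrite leNgt; apply/negP => hh; apply: nolox; exists h.
have key := gprod_no_loxodromic c0 nolox.
have /choice[s sP] : forall n : nat, exists g, Gamma g /\ n%:R < displ o g.
  by move=> n; have [g Gg ng] := unbdd n%:R; exists g.
have gs g : Gamma g -> gequiv o (g \o (fun n => s n o)) (fun n => s n o).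
  move=> Gg; apply/gequivP => a.
  pose b := Num.max 0 (2 * (a + c + 2 * delta) + displ o g).
  exists (Num.truncn b).+1 => i j Ni Nj /=.
  have b0 : 0 <= b by rewrite le_max lexx.
  have bi n : (Num.truncn b < n)%N -> b < displ o (s n).
    move=> bn; apply: lt_trans (sP n).2.
    apply: lt_le_trans (truncnS_gt _) _; by rewrite ler_nat.
  have ab : 2 * (a + c + 2 * delta) + displ o g <= b.
    by rewrite le_max lexx orbT.
  have gs : displ o (s i) <= displ o g + displ o (g * s i)%g.
    by rewrite -[X in displ o X](mulKg g) -[X in _ <= X + _]displV displM_le.
  have := key (g * s i)%g (s j) (2 * (a + c + 2 * delta)) _ (sP j).1 _ _.
  rewrite misomM => /(_ (subgroupM sgG Gg (sP i).1)) h.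
  have := bi _ Ni; have := bi _ Nj; have := displ_ge0 o g => ? ? ?.
  have := h ltac:(lra) ltac:(lra); lra.
apply: (@fixes_gclass _ (fun n => s n o)) => //.
exact: (gs 1%g (subgroup1 sgG)).
Qed.

End Boundary.

(** * The dynamics of a loxodromic isometry *)

Lemma pigeonhole_nat (T : choiceType) (A : set T) (f : nat -> T) :
  finite_set A -> (forall n, A (f n)) -> exists i j, (i < j)%N /\ f i = f j.
Proof.
move=> /finite_seqP[s ->] Af.
pose t := [seq f i | i <- iota 0 (size s).+1].
have : ~~ uniq t.
  apply/negP => ut; have /(uniq_leq_size ut) : {subset t <= s}.
    by move=> _ /mapP[i _ ->]; exact: Af.
  by rewrite size_map size_iota ltnn.
case/(uniqPn (f 0%N)) => i [j [ij]]; rewrite size_map size_iota => js.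
rewrite !(nth_map 0%N) ?size_iota ?(ltn_trans ij)// !nth_iota ?(ltn_trans ij)//.
by rewrite !add0n; exists i, j.
Qed.

Section Loxodromic.
Context (R : realType) (X : metricType R) (o : X).
Context (delta : R) (hyp : hyperbolic o delta) (delta0 : 0 <= delta).
Implicit Types (g h k u v : misom X).

Let gprod_trans_lt y x z a :
  a < gprod o x y -> a < gprod o y z -> a - delta < gprod o x z.
Proof.
move=> xy yz; apply: lt_le_trans (hyp x y z).
by rewrite ltrD2r lt_min xy yz.
Qed.

Let gprod_trans3_lt x y z w a :
  a < gprod o x y -> a < gprod o y z -> a < gprod o z w ->
  a - 2 * delta < gprod o x w.
Proof.
move=> xy yz zw; have xz := gprod_trans_lt xy yz; have ? := delta0.
by have := @gprod_trans_lt z x w (a - delta) xz ltac:(lra); lra.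
Qed.

(** The margin 3 delta + 1 gives |h^n| >= n, which stands in for the positivity
of the translation length. *)
Definition loxodromic h :=
  gprod o (h o) (h^-1%g o) + 3 * delta + 1 < displ o h / 2.

(** A bound for the products (h^n o|h^-m o): the distance, up to an additive
constant, from o to an axis of h. *)
Definition axis_defect h := gprod o (h o) (h^-1%g o) + 2 * delta.

Lemma loxodromicV h : loxodromic h -> loxodromic h^-1%g.
Proof. by rewrite /loxodromic displV invgK gprodC. Qed.

Lemma axis_defectV h : axis_defect h^-1%g = axis_defect h.
Proof. by rewrite /axis_defect invgK gprodC. Qed.

Lemma axis_defect_ge0 h : 0 <= axis_defect h.
Proof.
have := gprod_ge0 o (h o) (h^-1%g o); have := delta0.
by rewrite /axis_defect; lra.
Qed.

Lemma displVX h n : displ o (h^-1 ^+ n)%g = displ o (h ^+ n)%g.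
Proof. by rewrite expVgn displV. Qed.

(** Ping-pong with the sets {x : (x|h o) >= |h|/2} and
{x : (x|h^-1 o) >= |h|/2}: they are disjoint, and h maps the complement of the
second into the first. *)
Lemma gprod_pow1 h n : loxodromic h ->
  displ o h / 2 <= gprod o ((h ^+ n.+1)%g o) (h o).
Proof.
rewrite /loxodromic => lh; have C0 := gprod_ge0 o (h o) (h^-1%g o).
have ? := delta0.
elim: n => [|n IHn]; first by rewrite expg1 gprodxx -/(displ o h); lra.
rewrite expgS misomM gprod_actl leNgt; apply/negP => lt.
have := gprod_trans hyp (y := (h ^+ n.+1)%g o) (x := h o) (z := h^-1%g o)
  (a := displ o h / 2).
rewrite gprodC => /(_ IHn ltac:(lra)); lra.
Qed.

Lemma gprod_pow_opp h n m : loxodromic h ->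
  gprod o ((h ^+ n)%g o) ((h^-1 ^+ m)%g o) <= axis_defect h.
Proof.
move=> lh; have C1 := axis_defect_ge0 h; move: n m => [m|n [|m]].
- by rewrite expg0 gprod0l.
- by rewrite expg0 gprodC gprod0l.
have := gprod_pow1 n lh; have := gprod_pow1 m (loxodromicV lh).
rewrite displV; move: lh; rewrite /loxodromic => lh m1 n1.
rewrite leNgt; apply/negP => lt.
have ? := delta0.
have := @gprod_trans3_lt (h o) ((h ^+ n.+1)%g o) ((h^-1 ^+ m.+1)%g o)
  (h^-1%g o) (axis_defect h).
rewrite gprodC => /(_ _ lt); rewrite /axis_defect => /(_ ltac:(lra) ltac:(lra)).
lra.
Qed.

Lemma displ_pow_ge h n : loxodromic h -> n%:R <= displ o (h ^+ n)%g.
Proof.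
move=> lh; elim: n => [|n IHn]; first exact: displ_ge0.
rewrite expgS displM.
have := gprod_pow_opp n 1 lh; rewrite expg1 gprodC => le.
move: lh le; rewrite /loxodromic /axis_defect -natr1 => lh le.
have := delta0; lra.
Qed.

(** The rays n |-> h^n o are Gromov-convergent, with an explicit rate. *)
Lemma gprod_pow_same h n m a : loxodromic h ->
  a <= displ o (h ^+ n)%g -> a <= displ o (h ^+ m)%g ->
  a - axis_defect h <= gprod o ((h ^+ n)%g o) ((h ^+ m)%g o).
Proof.
move=> lh; wlog nm : n m / (n <= m)%N.
  move=> W an am; case/orP: (leq_total n m) => nm; first exact: W.
  by rewrite gprodC; exact: W.
move=> an _; rewrite -(subnKC nm) expgnDr misomM gprodC gprod_actl.
by have := gprod_pow_opp (m - n) n lh; rewrite expVgn; lra.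
Qed.

(** Either the ray of h and the image under g of the ray of k diverge, or they
converge to the same boundary point: a large product at one pair of far away
indices propagates backwards along both rays to every pair of indices. *)
Lemma gprod_rays g h k : loxodromic h -> loxodromic k ->
  (exists B, forall n m, gprod o ((h ^+ n)%g o) (g ((k ^+ m)%g o)) <= B) \/
  (exists D, forall n m a,
    a <= displ o (h ^+ n)%g -> a <= displ o (k ^+ m)%g ->
    a - D <= gprod o ((h ^+ n)%g o) (g ((k ^+ m)%g o))).
Proof.
move=> lh lk; have [|unbdd] := pselect (exists B, forall n m,
  gprod o ((h ^+ n)%g o) (g ((k ^+ m)%g o)) <= B); [by left|right].
pose C := axis_defect h + axis_defect k + displ o g.
exists (C + 2 * delta) => n m a an am.
(* One pair with a product beyond a + |g| forces both of its points to be at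
   distance at least a from o. *)
have [i [j ij]] : exists i j,
    a + displ o g < gprod o ((h ^+ i)%g o) (g ((k ^+ j)%g o)).
  apply: contrapT => nex; apply: unbdd; exists (a + displ o g) => i j.
  by rewrite leNgt; apply/negP => ?; apply: nex; exists i, j.
have g0 := displ_ge0 o g.
have ai : a <= displ o (h ^+ i)%g.
  by apply: le_trans (gprod_lel _ _ _); apply: le_trans (ltW ij); lra.
have aj : a <= displ o (k ^+ j)%g.
  have := gprod_ler o ((h ^+ i)%g o) (g ((k ^+ j)%g o)).
  by have := displM_le o g (k ^+ j)%g; rewrite {1}/displ misomM; lra.
have hh := axis_defect_ge0 h; have kk := axis_defect_ge0 k.
rewrite opprD addrA.
apply: (gprod_trans3 hyp (y := (h ^+ i)%g o) (z := g ((k ^+ j)%g o))) => //.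
- by have := gprod_pow_same lh an ai; rewrite /C; lra.
- by rewrite /C; lra.
- have := gprod_pow_same lk aj am.
  have := gprod_isom_ge o g ((k ^+ j)%g o) ((k ^+ m)%g o).
  by rewrite (metric_sym o) -/(displ o g) /C; lra.
Qed.

Lemma gequiv_rays g h D : loxodromic h ->
  (forall n m a, a <= displ o (h ^+ n)%g -> a <= displ o (h ^+ m)%g ->
    a - D <= gprod o ((h ^+ n)%g o) (g ((h ^+ m)%g o))) ->
  gequiv o (g \o (fun n => (h ^+ n)%g o)) (fun n => (h ^+ n)%g o).
Proof.
move=> lh hD; apply: gequiv_sym; apply/gequivP => a.
pose b := Num.max 0 (a + D).
exists (Num.truncn b).+1 => i j Ni Nj /=.
have b0 : 0 <= b by rewrite le_max lexx.
have bi n : (Num.truncn b < n)%N -> a + D <= displ o (h ^+ n)%g.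
  move=> bn; apply: le_trans (displ_pow_ge n lh).
  apply: (@le_trans _ _ b); first by rewrite le_max lexx orbT.
  by apply/ltW/(lt_le_trans (truncnS_gt _)); rewrite ler_nat.
by have := hD _ _ _ (bi _ Ni) (bi _ Nj); rewrite addrK.
Qed.

(** Bounds the distance from a point near the axis of h to the orbit of o under
the powers of h. *)
Definition axis_width h := displ o h / 2 + 1 / 2 + axis_defect h + 4 * delta.

(** An element v commuting with a power of h preserves the endpoints of h, so
v o is close to the axis of h.  The hypotheses on (v o|h o) and (v o|h^-1 o)
say that o is, coarsely, the point of the orbit of o under the powers of h
nearest to v o; hence v o is close to o.  In the proof the two rays of h are
seen from v o: by commutation, v^-1 h^N o is close to h^N o. *)
Lemma displ_centralizer h v p : (0 < p)%N -> loxodromic h ->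
  commute v (h ^+ p)%g ->
  gprod o (v o) (h o) <= (displ o h + 1) / 2 ->
  gprod o (v o) (h^-1%g o) <= (displ o h + 1) / 2 ->
  displ o v <= axis_width h.
Proof.
move=> p0 lh vp vh vh'.
pose B := displ o h / 2 + 1 / 2 + delta.
(* N is a multiple of p, so that v commutes with h^N, and is large enough for
   h^N o and v^-1 h^N o to be closer than the two rays of h can be. *)
pose N := (p * (Num.truncn (displ o v + axis_defect h + 2 * delta)).+1)%N.
have N0 : (0 < N)%N by rewrite muln_gt0 p0.
have ray k : loxodromic k -> displ o k = displ o h ->
    axis_defect k = axis_defect h -> commute v (k ^+ p)%g ->
    gprod o (v o) (k o) <= (displ o h + 1) / 2 ->
    axis_defect h + 2 * delta <
      gprod o ((k ^+ N)%g o) (v^-1%g ((k ^+ N)%g o)) /\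
    displ o v - B <= gprod o (v^-1%g o) (v^-1%g ((k ^+ N)%g o)).
  move=> lk kh akh vk vkh; split.
    have vN : commute v^-1%g (k ^+ N)%g.
      apply: commute_sym; apply: commuteV; apply: commute_sym.
      by rewrite /N expgnA; apply: commuteX.
    rewrite gprodC -misomM vN misomM gprod_actl.
    have := gprod_lel o (v^-1%g o) ((k ^+ N)^-1%g o).
    rewrite -/(displ o v^-1%g) displV => ?.
    have := displ_pow_ge N lk.
    have : displ o v + axis_defect h + 2 * delta < N%:R.
      apply: (lt_le_trans (truncnS_gt _)).
      by rewrite ler_nat /N leq_pmull.
    lra.
  rewrite gprodC gprod_actl displV invgK.
  have : gprod o ((k ^+ N)%g o) (v o) <= B.
    rewrite leNgt; apply/negP => lt.
    have hN : axis_defect h + displ o h / 2 + delta + 1 < displ o h.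
      by move: lh; rewrite /loxodromic /axis_defect; lra.
    have : displ o h - axis_defect h <= gprod o ((k ^+ N)%g o) (k o).
      have := gprod_pow_opp N.-1 1 lk; rewrite expg1 => opp.
      rewrite -(prednK N0) expgS misomM gprod_actl kh.
      by move: opp; rewrite akh; lra.
    rewrite gprodC in lt.
    move=> le; have := @gprod_trans_lt ((k ^+ N)%g o) (v o) (k o) B lt.
    by rewrite /B => /(_ ltac:(lra)); lra.
  lra.
have [p1 p2] := ray h lh erefl erefl vp vh.
have [q1 q2] : axis_defect h + 2 * delta <
      gprod o ((h^-1 ^+ N)%g o) (v^-1%g ((h^-1 ^+ N)%g o)) /\
    displ o v - B <= gprod o (v^-1%g o) (v^-1%g ((h^-1 ^+ N)%g o)).
  apply: ray; rewrite ?displV ?axis_defectV//; first exact: loxodromicV.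
  by rewrite expVgn; exact: commuteV.
rewrite gprodC in p2; rewrite gprodC in q1.
have mid := gprod_trans hyp p2 q2.
rewrite /axis_width leNgt; apply/negP => lt.
have := gprod_trans3_lt p1 _ q1 => /(_ ltac:(rewrite /B in mid; lra)).
have := gprod_pow_opp N N lh; lra.
Qed.

(** Translate u o by the power of h that minimises, up to an error 1, its
distance to o, and apply the previous lemma. *)
Lemma centralizer_near_axis h u p : (0 < p)%N -> loxodromic h ->
  commute u (h ^+ p)%g ->
  exists b n, displ o (((if b : bool then h else h^-1) ^+ n)^-1 * u)%g
    <= axis_width h.
Proof.
move=> p0 lh up.
(* The cyclic group generated by h. *)
pose E := [set e : misom X | exists n, e = (h ^+ n)%g \/ e = (h^-1 ^+ n)%g].
have Eh e : E e -> E (e * h)%g.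
  move=> [n [->|->]]; first by exists n.+1; left; rewrite expgSr.
  case: n => [|n]; first by exists 1%N; left; rewrite expg0 mul1g expg1.
  by exists n; right; rewrite expgSr mulgVK.
have EhV e : E e -> E (e * h^-1)%g.
  move=> [n [->|->]]; last by exists n.+1; right; rewrite expgSr.
  case: n => [|n]; first by exists 1%N; right; rewrite expg0 mul1g expg1.
  by exists n; left; rewrite expgSr mulgK.
have Ecomm e : E e -> commute e (h ^+ p)%g.
  move=> [n [->|->]]; first exact/commuteX2/commute_refl.
  apply: commuteX2; apply: commute_sym; apply: commuteV; exact: commute_refl.
pose S := [set displ o (e^-1 * u)%g | e in E].
have E1 : E 1%g by exists 0%N; left.
have infS : has_inf S.
  split; first by exists (displ o (1^-1 * u)%g), 1%g.
  by exists 0 => _ [e _ <-]; exact: displ_ge0.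
have [_ [e Ee <-] einf] := inf_adherent ltr01 infS.
have emin e' : E e' -> displ o (e^-1 * u)%g <= displ o (e'^-1 * u)%g + 1.
  move=> Ee'; apply: le_trans (ltW einf) _; rewrite lerD2r.
  by apply: (ge_inf infS.2); exists e'.
have ev : displ o (e^-1 * u)%g <= axis_width h.
  apply: (displ_centralizer p0 lh).
  - apply: commute_sym; apply: commuteM; last exact: commute_sym.
    by apply: commuteV; apply: commute_sym; exact: Ecomm.
  - have := emin _ (Eh _ Ee); rewrite invgM -mulgA (displM _ h^-1%g).
    by rewrite invgK displV gprodC; lra.
  - have := emin _ (EhV _ Ee); rewrite invgM invgK -mulgA (displM _ h) gprodC.
    lra.
case: Ee ev => n [->|->] ev; [by exists true, n|by exists false, n].
Qed.

Context (Gamma : set (misom X)) (sgG : is_subgroup Gamma).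
Context (tfG : torsion_free Gamma).
Context (lfG : forall r, finite_set [set g | Gamma g /\ displ o g <= r]).

(** Fellow-travelling rays keep h^-n g k^n in a ball of Gamma, which is finite:
two of these elements coincide. *)
Lemma rays_commensurable g h k D : Gamma g -> Gamma h -> Gamma k ->
  (forall n, displ o (h ^+ n)%g = displ o (k ^+ n)%g) ->
  (forall n m a, a <= displ o (h ^+ n)%g -> a <= displ o (k ^+ m)%g ->
    a - D <= gprod o ((h ^+ n)%g o) (g ((k ^+ m)%g o))) ->
  exists2 p, (0 < p)%N & (h ^+ p * g = g * k ^+ p)%g.
Proof.
move=> Gg Gh Gk hk hD.
pose f n := ((h ^+ n)^-1 * (g * k ^+ n))%g.
have [|i [j [ij fij]]] := pigeonhole_nat (f := f) (lfG (displ o g + 2 * D)).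
  move=> n; split; first by apply: (subgroupM sgG);
    [apply: (subgroupV sgG)|apply: (subgroupM sgG) => //]; exact: subgroupX.
  rewrite -(displ_prod o) (mdist_gprod o) -!/(displ o _).
  have := hD n n (displ o (h ^+ n)%g) (lexx _); rewrite {1}hk => /(_ (lexx _)).
  have := displM_le o g (k ^+ n)%g; rewrite -hk misomM; lra.
exists (j - i)%N; first by rewrite subn_gt0.
have hj : (h ^+ j = h ^+ (j - i) * h ^+ i)%g by rewrite -expgnDr subnK// ltnW.
have kj : (k ^+ j = k ^+ (j - i) * k ^+ i)%g by rewrite -expgnDr subnK// ltnW.
move: fij; rewrite /f hj kj invgM -!mulgA => fij.
move: fij => /mulgI; rewrite !mulgA => /mulIg gE.
by rewrite [in LHS]gE !mulgA mulgV mul1g.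
Qed.

Lemma commute_inverted (G : groupType) (g a : G) (b : nat) :
  (a * g = g * a^-1)%g -> (a ^+ b * g = g * a ^- b)%g.
Proof.
move=> ag; elim: b => [|b IHb]; first by rewrite expg0 invg1 mul1g mulg1.
by rewrite expgSr -mulgA ag mulgA IHb -mulgA -invgM -expgS expgSr.
Qed.

(** The element u = g^2 commutes with h^p.  Its powers stay near the axis of h,
hence by finiteness of balls u^l = h^q for some l > 0 and some integer q.  This
power commutes with g, while its p-th power is inverted by g: so u, and
therefore g, has finite order. *)
Lemma no_axis_reversal h g p : Gamma h -> Gamma g -> loxodromic h ->
  (0 < p)%N -> (h ^+ p * g = g * h^-1 ^+ p)%g -> False.
Proof.
move=> Gh Gg lh p0 hg; pose u := (g ^+ 2)%g.
rewrite expVgn in hg.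
have hgV : (h ^- p * g = g * h ^+ p)%g.
  by apply: (mulgI (h ^+ p)%g); rewrite mulVKg mulgA hg mulgVK.
have up : commute u (h ^+ p)%g.
  by rewrite /commute /u expg2 -mulgA -hgV mulgA -hg mulgA.
have /choice[f fP] : forall j, exists bn : bool * nat, displ o
   (((if bn.1 then h else h^-1) ^+ bn.2)^-1 * u ^+ j)%g <= axis_width h.
  move=> j; have [|b [n]] := @centralizer_near_axis h (u ^+ j)%g p p0 lh.
    by apply: commute_sym; apply: commuteX; exact: commute_sym.
  by exists (b, n).
pose k b := if b : bool then h else h^-1%g.
have Gk b : Gamma (k b) by case: b => //; exact: (subgroupV sgG).
have Gu : Gamma u by exact: (subgroupX sgG).
pose w j := ((k (f j).1 ^+ (f j).2)^-1 * u ^+ j)%g.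
have [||i [j [ij fij]]] := @pigeonhole_nat _
    ([set: bool] `*` [set g | Gamma g /\ displ o g <= axis_width h])
    (fun j => ((f j).1, w j)).
- by apply: finite_setX; [exact: finite_finset|exact: lfG].
- move=> j; split=> //=; split; last exact: fP.
  by apply: (subgroupM sgG); [apply: (subgroupV sgG)|]; exact: (subgroupX sgG).
have fb : (f i).1 = (f j).1 := congr1 fst fij.
have fw : w i = w j := congr1 snd fij.
have [c [q uq]] : exists c q, (u ^+ (j - i) = k c ^+ q)%g.
  have : (u ^+ (j - i) = k (f j).1 ^+ (f j).2 * (k (f j).1 ^+ (f i).2)^-1)%g.
    rewrite expgnFr; last exact: ltnW.
    have uE n : (u ^+ n = k (f n).1 ^+ (f n).2 * w n)%g by rewrite /w mulVKg.
    rewrite (uE j) (uE i) fw fb invgM; move: (w j) => wj.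
    by rewrite !mulgA mulgK.
  have kN b : k (~~ b) = (k b)^-1%g by case: b; rewrite /= ?invgK.
  move: (f j).1 (f j).2 (f i).2 => b n m ->.
  case: (leqP m n) => [mn|/ltnW nm].
    by exists b, (n - m)%N; rewrite expgnFr.
  by exists (~~ b), (m - n)%N; rewrite kN expVgn expgnFr// invgF.
pose z := (k c ^+ (p * q))%g.
have zg : (z * g = g * z^-1)%g.
  rewrite /z expgnA; apply: commute_inverted.
  by case: (c); rewrite /= ?hg// expVgn invgK.
have zu : z = (g ^+ (2 * (j - i) * p))%g by rewrite /z mulnC !expgnA -uq.
have zz : (z ^+ 2 = 1)%g.
  have : (g * z = g * z^-1)%g.
    by rewrite -zg zu; apply: commuteX; exact: commute_refl.
  by move=> /mulgI zV; rewrite expg2 {2}zV mulgV.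
have g1 : g = 1%g.
  apply: (@tfG g (2 * (j - i) * p * 2)%N) => //.
    by rewrite !muln_gt0 subn_gt0 ij p0.
  by rewrite expgnA -zu.
have hh : (h ^+ (p + p) = 1)%g.
  by rewrite expgnDr; move: hg; rewrite g1 mulg1 mul1g => {2}->; rewrite mulgV.
have := displ_pow_ge (p + p) lh; rewrite hh displ1.
by rewrite -[0]/(0%:R) ler_nat leqNgt addn_gt0 p0.
Qed.

End Loxodromic.

(** * A pair of loxodromic elements without common endpoints *)

Section Transversal.
Context (R : realType) (X : metricType R) (o : X).
Context (delta : R) (hyp : hyperbolic o delta) (delta0 : 0 <= delta).
Implicit Types (g h k u v : misom X).
Context (Gamma : set (misom X)) (sgG : is_subgroup Gamma).
Context (tfG : torsion_free Gamma).
Context (lfG : forall r, finite_set [set g | Gamma g /\ displ o g <= r]).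
Context (nofix : ~ fixes_boundary_point o Gamma).

(** The products (h^n o|g h^n o) = (h^n o|h^n g o) are unbounded along the
multiples n of p. *)
Lemma commute_gequiv h g p : loxodromic o delta h -> (0 < p)%N ->
  (h ^+ p * g = g * h ^+ p)%g ->
  gequiv o (g \o (fun n => (h ^+ n)%g o)) (fun n => (h ^+ n)%g o).
Proof.
move=> lh p0 hg.
have [[B hB]|[D hD]] := gprod_rays hyp delta0 g lh lh; last first.
  exact: (gequiv_rays hyp delta0 lh hD).
exfalso; pose n := (p * (Num.truncn (B + displ o g)).+1)%N.
have := hB n n.
have -> : g ((h ^+ n)%g o) = (h ^+ n)%g (g o).
  rewrite -!misomM; congr (misom_fun _ _); rewrite /n expgnA.
  by apply: commuteX.
rewrite gprodC gprod_actl.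
have := displ_pow_ge hyp delta0 n lh.
have := gprod_lel o (g o) ((h ^+ n)^-1%g o); rewrite -/(displ o g).
have : B + displ o g < n%:R.
  by apply: (lt_le_trans (truncnS_gt _)); rewrite ler_nat /n leq_pmull.
lra.
Qed.

(** Take g in Gamma moving the attracting endpoint of h. *)
Lemma exists_transversal h : Gamma h -> loxodromic o delta h ->
  exists2 g, Gamma g & exists B, forall b b' n m,
    gprod o (((if b : bool then h else h^-1) ^+ n)%g o)
      (g (((if b' : bool then h else h^-1) ^+ m)%g o)) <= B.
Proof.
move=> Gh lh.
have [g [Gg ng]] : exists g, Gamma g /\
   ~ gequiv o (g \o (fun n => (h ^+ n)%g o)) (fun n => (h ^+ n)%g o).
  apply: contrapT => nex; apply: nofix.
  have all g : Gamma g ->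
      gequiv o (g \o (fun n => (h ^+ n)%g o)) (fun n => (h ^+ n)%g o).
    by move=> Gg; apply: contrapT => ?; apply: nex; exists g.
  apply: (@fixes_gclass _ _ o delta hyp _ (fun n => (h ^+ n)%g o)) => //.
  exact: (all 1%g (subgroup1 sgG)).
pose k b := if b : bool then h else h^-1%g.
have lk b : loxodromic o delta (k b) by case: b => //; exact: loxodromicV.
have Gk b : Gamma (k b) by case: b => //; exact: (subgroupV sgG).
have dk b n : displ o (k b ^+ n)%g = displ o (h ^+ n)%g.
  by case: b => //; rewrite displVX.
have bdd : forall bb : bool * bool, exists B, forall n m,
    gprod o ((k bb.1 ^+ n)%g o) (g ((k bb.2 ^+ m)%g o)) <= B.
  move=> [b b'] /=.
  have [//|[D hD]] := gprod_rays hyp delta0 g (lk b) (lk b').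
  have [|p p0 hp] := rays_commensurable sgG lfG Gg (Gk b) (Gk b') _ hD.
    by move=> n; rewrite !dk.
  exfalso; case: b b' hp {hD} => -[] /= hp.
  - by apply: ng; exact: commute_gequiv hp.
  - exact: (no_axis_reversal hyp delta0 sgG tfG lfG Gh Gg lh p0 hp).
  - apply: (no_axis_reversal hyp delta0 sgG tfG lfG (Gk false) Gg) p0 _.
      exact: lk.
    by rewrite /k invgK.
  - apply: ng; apply: (commute_gequiv lh p0).
    move: hp; rewrite !expVgn => hp; apply: commute_sym.
    by rewrite -[(h ^+ p)%g]invgK; apply: commuteV; exact: esym.
have /choice[B BP] := bdd.
exists g => //; exists (\big[Num.max/0]_(bb : bool * bool) B bb) => b b' n m.
apply: le_trans (BP (b, b') n m) _.
exact: (le_bigmax_cond _ (j := (b, b'))).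
Qed.

(** h is loxodromic and g o is far from its ping-pong sets; the constant C is
kept apart from h because long elements h with the same C are needed. *)
Definition transverse C h g := [/\ C + 4 * delta + 1 < displ o h / 2,
  gprod o (h o) (h^-1%g o) <= C, gprod o (h o) (g o) <= C &
  gprod o (h^-1%g o) (g o) <= C].

(** The pair consists of k = h^n and l = g h^n g^-1, with g as in the previous
lemma and n so large that both displacements exceed the constant C, which does
not depend on n.  If f o is close to k o or to k^-1 o, then it is far from
both l o and l^-1 o, since the latter are far from the former. *)
Lemma exists_transverse_pair :
  (forall B, exists2 g, Gamma g & B < displ o g) ->
  exists C, exists2 h : bool -> misom X, (forall b, Gamma (h b)) &
    0 <= C /\ forall g, exists b, transverse C (h b) g.
Proof.
move=> unbdd.
have c0 : 0 <= 3 * delta + 1 by have := delta0; lra.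
have [h Gh lh] := exists_loxodromic hyp delta0 sgG c0 nofix unbdd.
have {}lh : loxodromic o delta h by rewrite /loxodromic; lra.
have [g Gg [B hB]] := exists_transversal Gh lh.
have B0 : 0 <= B by apply: le_trans (hB true true 0%N 0%N); exact: gprod_ge0.
have g0 := displ_ge0 o g.
have a0 := axis_defect_ge0 o delta0 h.
(* B + |g| bounds the products between the two axes; the other terms allow for
   the base point change by g and for one use of hyperbolicity. *)
pose C := B + 4 * displ o g + delta + axis_defect o delta h + 1.
pose n := (Num.truncn (2 * (C + 4 * delta + 1) + 2 * displ o g)).+1.
have nC : 2 * (C + 4 * delta + 1) + 2 * displ o g < displ o (h ^+ n)%g.
  by apply: lt_le_trans (truncnS_gt _) _; exact: displ_pow_ge.
pose k b := ((if b : bool then h else h^-1) ^+ n)%g.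
pose l b := (g * (k b * g^-1))%g.
have kV b : k (~~ b) = (k b)^-1%g by case: b; rewrite /k /= expVgn ?invgK.
have lV b : l (~~ b) = (l b)^-1%g.
  by rewrite /l kV !invgM !invgK mulgA.
have lg b x : gprod o (l b o) x <= gprod o (g (k b o)) x + displ o g.
  have := gprod_lip o (l b o) (g (k b o)) x.
  by rewrite /l !misomM !misom_mdist -/(displ o g^-1%g) displV.
have kl b b' : gprod o (k b o) (l b' o) <= B + displ o g.
  rewrite gprodC; apply: le_trans (lg _ _) _.
  by rewrite gprodC lerD2r; exact: hB.
have kk : gprod o (k true o) (k false o) <= axis_defect o delta h.
  exact: gprod_pow_opp.
have ll : gprod o (l true o) (l false o) <=
    axis_defect o delta h + 3 * displ o g.
  apply: le_trans (lg _ _) _.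
  rewrite gprodC; have := lg false (g (k true o)).
  have := gprod_act_le o g (k false o) (k true o).
  rewrite (gprodC o (k false o)).
  by rewrite /= in kk *; lra.
have dk : displ o (k true) = displ o (h ^+ n)%g by [].
have dl : displ o (h ^+ n)%g - 2 * displ o g <= displ o (l true).
  have := displM_le o (g^-1 * l true)%g g; have := displM_le o g^-1%g (l true).
  by rewrite displV /l mulKg mulgVK dk; lra.
exists C, (fun b => if b then k true else l true).
  have Gk : Gamma (k true) by exact: (subgroupX sgG).
  case=> //; apply: (subgroupM sgG) => //; apply: (subgroupM sgG) => //.
  exact: (subgroupV sgG).
have d0 := delta0.
split=> [|f]; first by rewrite /C; lra.
have [kf|[b kf]] : (forall b, gprod o (k b o) (f o) <= C) \/
    exists b, C < gprod o (k b o) (f o).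
  have [|nk] := pselect (forall b, gprod o (k b o) (f o) <= C); first by left.
  right; apply: contrapT => nex; apply: nk => b.
  by rewrite leNgt; apply/negP => ?; apply: nex; exists b.
- exists true; split; rewrite -?(kV true) //=.
  + by rewrite dk; lra.
  + by rewrite /C; have := kk; rewrite /=; lra.
have lf b' : gprod o (l b' o) (f o) <= C.
  rewrite leNgt; apply/negP => lt.
  have := gprod_trans hyp (x := k b o) (y := f o) (z := l b' o) (a := C).
  rewrite (gprodC o (f o)) => /(_ (ltW kf) (ltW lt)).
  by have := kl b b'; rewrite /C; lra.
exists false; split; rewrite -?(lV true) //=.
- by lra.
- by rewrite /C; have := ll; rewrite /=; lra.
- exact: (lf true).
- exact: (lf false).
Qed.

End Transversal.

(** * Local finiteness of discrete groups *)

Section LocalFiniteness.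
Context (R : realType) (X : metricType R) (o : X).
Implicit Types (g h : misom X).

(** On compact sets, a neighbourhood of the identity for the compact-open
topology contains every map that is uniformly close to the identity on a large
ball.  One parameter e serves for the radius 1/e and for the precision e. *)
Lemma compact_open_nbhs_id (V : set {compact-open, X -> X}) :
  nbhs (id : {compact-open, X -> X}) V ->
  exists2 e : R, 0 < e &
    forall f : X -> X,
      (forall x, mdist x o <= e^-1 -> mdist x (f x) < e) -> V f.
Proof.
pose B (e : R) : set (X -> X) :=
  [set f | forall x, mdist x o <= e^-1 -> mdist x (f x) < e].
pose F : set_system (X -> X) := filter_from [set e : R | 0 < e] B.
have BS e e' : 0 < e -> e <= e' -> B e `<=` B e'.
  move=> e0 ee' f fe x xe'; apply: lt_le_trans (ee'); apply: fe.
  apply: le_trans xe' _; rewrite lef_pV2 ?posrE//; exact: lt_le_trans ee'.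
have FF : Filter F.
  apply: filter_from_filter; first by exists 1 => /=.
  move=> e e' /= e0 e'0; have m0 : 0 < Num.min e e' by rewrite lt_min e0 e'0.
  by exists (Num.min e e') => // f Bf; split; apply: BS Bf;
    rewrite // ge_min lexx ?orbT.
suff : {compact-open, F --> id} by move=> cvF /cvF.
apply/compact_open_cvgP => K O cK oO KO.
have := (compact_near_coveringP K).1 cK _ F (fun f x => O (f x)) FF.
case=> [x Kx|e /= e0 eK]; last first.
  by exists e => // f /eK fK _ [x Kx <-]; exact: fK.
have Ox : O x by apply: KO; exists x.
move: oO; rewrite openE => /(_ _ Ox) /nbhs_ballP[r /= r0 rO].
pose e := Num.min (r / 2) (mdist x o + r)^-1.
have d0 := mdist_ge0 x o.
have xr0 : 0 < mdist x o + r by lra.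
have e0 : 0 < e by rewrite /e lt_min divr_gt0//= invr_gt0.
exists (ball x (r / 2), B e) => /=.
  by split; [apply: nbhsx_ballx; rewrite divr_gt0|exists e].
move=> [y f] /= [xy Bf]; apply: rO.
rewrite ballEmdist /= in xy; rewrite ballEmdist /=.
have er : e <= r / 2 by rewrite ge_min lexx.
have xre : mdist x o + r <= e^-1.
  rewrite -[X in X <= _]invrK lef_pV2 ?posrE ?invr_gt0//.
  by rewrite ge_min lexx orbT.
have yf : mdist y (f y) < e.
  by apply: Bf; have := metric_triangle y x o; rewrite (metric_sym y x); lra.
by have := metric_triangle x y (f y); lra.
Qed.

Lemma discrete_displacement (Gamma : set (misom X)) :
  discrete_subset Gamma -> Gamma 1%g ->
  exists2 e : R, 0 < e &
    forall g, Gamma g ->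
      (forall x, mdist x o <= e^-1 -> mdist x (g x) < e) -> g = 1%g.
Proof.
move=> dG G1; have [_ [V nV VG]] := dG _ G1.
move: nV; rewrite nbhsE => -[W [[U oU UW] W1] WV].
have [|e e0 eU] := @compact_open_nbhs_id U.
  by apply: open_nbhs_nbhs; split=> //; rewrite -UW in W1.
exists e => // g Gg ge; have : (V `&` Gamma) g.
  by split=> //; apply: WV; rewrite -UW; exact: eU.
by rewrite VG.
Qed.

Context (properX : proper_metric X).

(** Compactness, in its near-covering form, is applied to the filter of finite
lists ordered by inclusion. *)
Lemma proper_finite_net r e : 0 < e -> exists D : seq X,
  forall x, mdist x o <= r -> exists2 c, c \in D & mdist c x < e.
Proof.
move=> e0; have : compact [set y : X | mdist y o <= r].
  by have := @properX o r; congr compact; apply/seteqP; split=> y /=;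
    rewrite metric_sym.
pose F : set_system (seq X) :=
  filter_from setT (fun L : seq X => [set L' : seq X | {subset L <= L'}]).
have FF : Filter F.
  apply: filter_from_filter; first by exists [::].
  move=> L L' _ _; exists (L ++ L') => // M LM.
  by split=> x xL; apply: LM; rewrite mem_cat xL ?orbT.
move=> /compact_near_coveringP/(_ _ F
  (fun L x => exists2 c, c \in L & mdist c x < e) FF)[x _|L _ LK].
  exists (ball x e, [set L | x \in L]) => /=.
    split; first exact: nbhsx_ballx.
    by exists [:: x] => // L /(_ x); rewrite inE eqxx; exact.
  by move=> [y L] /= [+ xL]; rewrite ballEmdist => xy; exists x.
by exists L => x; apply: LK.
Qed.

Lemma infinite_almost_equal (S : set (misom X)) r e (L : seq X) :
  0 < e -> infinite_set S -> S `<=` [set g | displ o g <= r] ->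
  exists S', [/\ infinite_set S', S' `<=` S &
    forall g h c, S' g -> S' h -> c \in L -> mdist (g c) (h c) < e].
Proof.
move=> e0 infS Sr; elim: L => [|c L [S1 [infS1 S1S S1L]]].
  by exists S; split.
have e20 : 0 < e / 2 by rewrite divr_gt0.
have [D DP] := proper_finite_net (r + mdist c o) e20.
pose T p := [set g | S1 g /\ mdist p (g c) < e / 2].
have [p [_ infT]] : exists p, [set` D] p /\ infinite_set (T p).
  apply: contrapT => nex; apply: infS1.
  apply: (@sub_finite_set _ _ (\bigcup_(p in [set` D]) T p)).
    move=> g S1g; have [|p pD pg] := DP (g c); last by exists p.
    have := metric_triangle (g c) (g o) o; rewrite misom_mdist -/(displ o g).
    by have := Sr _ (S1S _ S1g); rewrite /=; lra.
  apply: bigcup_finite => // p pD; apply: contrapT => infT.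
  by apply: nex; exists p.
exists (T p); split=> // [g [/S1S]//|g h c' [gS pg] [hS ph]].
rewrite inE => /orP[/eqP->|]; last exact: S1L.
have := metric_triangle (g c) p (h c); rewrite (metric_sym (g c) p).
lra.
Qed.

(** Among infinitely many elements of bounded displacement, two almost agree on
a finite net of a large ball; their quotient is then close to the identity,
hence equal to it. *)
Lemma discrete_locally_finite (Gamma : set (misom X)) r :
  is_subgroup Gamma -> discrete_subset Gamma ->
  finite_set [set g | Gamma g /\ displ o g <= r].
Proof.
move=> sgG dG; apply: contrapT => infS.
have [e e0 eG] := discrete_displacement dG (subgroup1 sgG).
have e40 : 0 < e / 4 by rewrite divr_gt0.
have [D DP] := proper_finite_net e^-1 e40.
have e20 : 0 < e / 2 by rewrite divr_gt0.
have [S [infS' SS SD]] :=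
  infinite_almost_equal D e20 infS (fun g => @proj2 _ _).
have [g Sg] := infinite_setN0 infS'.
have [h [Sh hg]] : (S `\ g) !=set0.
  by apply: infinite_setN0; apply: infinite_setD.
apply: hg => /=; rewrite -[h](mulVKg g).
suff -> : (g^-1 * h)%g = 1%g by rewrite mulg1.
apply: eG.
  apply: (subgroupM sgG); last exact: (SS _ Sh).1.
  exact: (subgroupV sgG (SS _ Sg).1).
move=> x xe; have [c cD cx] := DP _ xe.
rewrite misomM metric_sym mdistVl.
have := SD h g c Sh Sg cD; have := metric_triangle (h x) (h c) (g x).
have := metric_triangle (h c) (g c) (g x); rewrite !misom_mdist.
rewrite (metric_sym x c); lra.
Qed.

End LocalFiniteness.

(** * Exponential growth from ping-pong *)

Section Counting.
Context (R : realType) (T : choiceType).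
Implicit Types (A : set T) (s : seq T).

Lemma counting_ge_size A s : uniq s -> [set` s] `<=` A ->
  ((size s)%:R%:E <= counting A :> \bar R)%E.
Proof.
move=> us sA; rewrite /counting.
case: asboolP => [finA|_]; last by rewrite leey.
rewrite lee_fin ler_nat; apply: uniq_leq_size => // x xs.
by rewrite in_fset_set// inE; exact: sA.
Qed.

Lemma counting_le_size A s : A `<=` [set` s] ->
  (counting A <= (size s)%:R%:E :> \bar R)%E.
Proof.
move=> As; have finA : finite_set A by apply: sub_finite_set As _.
rewrite /counting asboolT// lee_fin ler_nat; apply: uniq_leq_size.
  exact: finmap.fset_uniq.
by move=> x; rewrite in_fset_set// inE => /As.
Qed.

End Counting.

Section SubgroupGen.
Context (G : groupType) (A : set G).

Lemma subgroup_gen_subgroup : is_subgroup (subgroup_gen A).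
Proof.
split=> [|g h]; rewrite !inE; first by move=> H [sgH _]; exact: subgroup1.
move=> Ag Ah H [sgH AH]; apply: (subgroupM sgH); first exact: Ag.
by apply: (subgroupV sgH); exact: Ah.
Qed.

Lemma subgroup_gen_min (H : set G) : is_subgroup H -> A `<=` H ->
  subgroup_gen A `<=` H.
Proof. by move=> sgH AH g; apply. Qed.

Lemma mem_subgroup_gen : A `<=` subgroup_gen A.
Proof. by move=> g Ag H [_]; apply. Qed.

End SubgroupGen.

Section Growth.
Context (R : realType) (X : metricType R) (o : X).
Implicit Types (g h : misom X).

Lemma critical_exponent_ge (H : set (misom X)) (t : R) (N M : nat) :
  (0 < M)%N -> expR (t * M%:R) <= N%:R ->
  (forall k, (0 < k)%N -> exists2 s : seq X, uniq s /\ size s = (N ^ k)%N &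
     forall x, x \in s -> mdist x o < (k * M)%:R /\ exists2 g, H g & x = g o) ->
  (t%:E <= critical_exponent o H)%E.
Proof.
move=> M0 tN NH; apply: le_ereal_inf_tmp => _ [A [n0 _ n0A] <-].
have [s [us ss] sH] := NH n0.+1 isT.
pose n := (n0.+1 * M)%N.
have n_gt0 : (0 < n)%N by rewrite muln_gt0.
apply: le_trans (ereal_sup_ubound _); last first.
  exists n => //; apply: n0A => /=.
  by rewrite (leq_trans (leqnSn _))// leq_pmulr.
have nR : 0 < n%:R :> R by rewrite ltr0n.
have -> : t%:E = ((n%:R^-1)%:E * (t * n%:R)%:E)%E.
  by rewrite -EFinM mulrC mulfK// gt_eqF.
apply: lee_wpmul2l; first by rewrite lee_fin invr_ge0 ltW.
have le : ((expR (t * n%:R))%:E <=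
    counting (ball o n%:R `&` [set g o | g in H]))%E.
  apply: (@le_trans _ _ ((size s)%:R%:E)).
    have -> : t * n%:R = t * M%:R * n0.+1%:R by rewrite /n natrM mulrA mulrAC.
    rewrite lee_fin ss natrX expRM_natr.
    by apply: lerXn2r => //; rewrite nnegrE// expR_ge0.
  apply: counting_ge_size => // x /= /sH[xn [g Hg xg]]; rewrite xg in xn *.
  by split; [rewrite ballEmdist /= metric_sym; exact: xn|exists g].
apply: (@le_trans _ (\bar R) (lne (expR (t * n%:R))%:E)).
  by rewrite lne_EFin ?expR_gt0// expRK.
rewrite lee_lne//.
- by rewrite in_itv /= lee_fin expR_ge0 leey.
- rewrite in_itv /= leey andbT; apply: le_trans le.
  by rewrite lee_fin expR_ge0.
Qed.

(** The images of o under the positive words of length k in G, listed with the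
multiplicity of the words. *)
Fixpoint word_orbit (G : seq (misom X)) k : seq X :=
  if k is k'.+1 then [seq (g : misom X) x | g <- G, x <- word_orbit G k']
  else [:: o].

Lemma size_word_orbit G k : size (word_orbit G k) = (size G ^ k)%N.
Proof. by elim: k => //= k IHk; rewrite size_allpairs IHk expnS. Qed.

Lemma word_orbitP (H : set (misom X)) G M k : is_subgroup H ->
  (forall g, g \in G -> H g /\ displ o g <= M) ->
  forall x, x \in word_orbit G k ->
    mdist x o <= k%:R * M /\ exists2 g, H g & x = g o.
Proof.
move=> sgH GH; elim: k => [|k IHk] x /=.
  rewrite inE => /eqP ->; rewrite mul0r mdistxx; split=> //.
  by exists 1%g => //; exact: subgroup1.
case/allpairsP => -[g y] /= [/GH[Hg gM] /IHk[yk [h Hh yE]] ->]; split.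
  have := metric_triangle (g y) (g o) o; rewrite misom_mdist -/(displ o g).
  by rewrite -natr1 mulrDl mul1r; lra.
by exists (g * h)%g; [exact: (subgroupM sgH)|rewrite yE].
Qed.

(** The image of o under a positive word starting with g lies in Y g true: the
first letter of the word can be read off the point. *)
Lemma word_orbit_uniq G (Y : misom X -> bool -> set X) k : uniq G ->
  (forall g s, g \in G -> ~ Y g s o) ->
  (forall g h s t, g \in G -> h \in G -> (g, s) <> (h, t) ->
     Y g s `&` Y h t `<=` set0) ->
  (forall g x, g \in G -> ~ Y g false x -> Y g true (g x)) ->
  uniq (word_orbit G k).
Proof.
move=> uG Yo YI Yg.
have Yk j x g : x \in word_orbit G j -> g \in G -> ~ Y g false x.
  elim: j x g => [|j IHj] x g; first by rewrite inE => /eqP -> gG; exact: Yo.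
  case/allpairsP => -[h y] /= [hG yj ->] gG Yghy.
  apply: (YI h g true false hG gG _ (h y)); first by [].
  by split=> //; apply: Yg => //; exact: IHj.
elim: k => //= k IHk; apply: allpairs_uniq => //.
move=> [g x] [h y] /allpairsP[[g' x'] /= [gG xk [-> ->]]].
move=> /allpairsP[[h' y'] /= [hG yk [-> ->]]] gxhy.
have [gh|/eqP gh] := eqVneq g' h'.
  rewrite gh in gxhy *; congr pair.
  exact: (can_inj (misom_funK h')).
exfalso; apply: (YI g' h' true true gG hG _ (g' x')); first by case.
split; first by apply: Yg => //; exact: Yk xk gG.
by rewrite gxhy; apply: Yg => //; exact: Yk yk hG.
Qed.

End Growth.

(** * Schottky groups generated by conjugates *)

Section Schottky.
Context (R : realType) (X : metricType R) (o : X).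
Context (delta : R) (hyp : hyperbolic o delta) (delta0 : 0 <= delta).
Implicit Types (g h k u v : misom X) (x y : X).
Context (C m : R) (S : seq (misom X)) (eta : misom X -> misom X).
Context (C0 : 0 <= C) (mC : C + delta + 1 <= m).
Context (Setat : forall g, g \in S -> transverse o delta C (eta g) g^-1%g).
Context (Sm : forall g, g \in S -> m <= displ o g < m + 1).
Context (Ssep : forall g h, g \in S -> h \in S -> g <> h ->
  2 * (C + 3 * delta + 1) < mdist (g o) (h o)).

Let hs g (s : bool) := if s then eta g else (eta g)^-1%g.

(** The translate by g of the ping-pong sets of eta g, where s selects the
attracting or the repelling one. *)
Definition pingpong_set g (s : bool) : set X :=
  [set x | displ o (eta g) / 2 <= gprod o (g^-1%g x) (hs g s o)].

Local Notation Y := pingpong_set.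

Definition pingpong_gen g := (g * eta g * g^-1)%g.

(** Since eta g is transverse to g^-1, its ping-pong sets are far from g^-1 o,
and g maps them into the shadow of g o. *)
Let Y_shadow g s x : g \in S -> Y g s x ->
  displ o g - C - delta <= gprod o x (g o).
Proof.
move=> gS; have [hC hh hg hg'] := Setat gS; rewrite /Y /= => Yx.
have := gprod_actl o g (g^-1%g x); rewrite misomVK => ->.
suff : gprod o (g^-1%g x) (g^-1%g o) <= C + delta by lra.
rewrite leNgt; apply/negP => lt.
have sg : gprod o (hs g s o) (g^-1%g o) <= C by rewrite /hs; case: s {Yx}.
have := gprod_trans hyp (x := hs g s o) (y := g^-1%g x) (z := g^-1%g o)
  (a := Num.min (displ o (eta g) / 2) (gprod o (g^-1%g x) (g^-1%g o))).
rewrite (gprodC o (hs g s o) (g^-1%g x)) !ge_min Yx lexx orbT => /(_ isT isT).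
have : C + delta <
    Num.min (displ o (eta g) / 2) (gprod o (g^-1%g x) (g^-1%g o)).
  by rewrite lt_min lt andbT; have := delta0; lra.
lra.
Qed.

Let Y_far g s x : g \in S -> Y g s x -> m - C - delta <= mdist x o.
Proof.
move=> gS /(Y_shadow gS); have := gprod_lel o x (g o).
have /andP[] := Sm gS; lra.
Qed.

Let Y_opp g s t x y : g \in S -> s <> t -> Y g s x -> Y g t y ->
  gprod o (g^-1%g x) (g^-1%g y) <= C + 2 * delta.
Proof.
move=> gS st; have [hC hh hg hg'] := Setat gS; rewrite /Y /= => Yx Yy.
rewrite leNgt; apply/negP => lt; have d0 := delta0.
have stC : gprod o (hs g s o) (hs g t o) <= C.
  by case: s t st {Yx Yy} => -[]//= _; rewrite gprodC.
pose a := Num.min (displ o (eta g) / 2) (gprod o (g^-1%g x) (g^-1%g y)).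
have aC : C + 2 * delta < a by rewrite /a lt_min lt andbT; lra.
have := gprod_trans3 hyp (x := hs g s o) (y := g^-1%g x) (z := g^-1%g y)
  (w := hs g t o) (a := a).
rewrite (gprodC o (hs g s o) (g^-1%g x)) /a !ge_min Yx Yy lexx orbT -/a.
by move=> /(_ isT isT isT d0); lra.
Qed.

(** The shadows of g o and h o are apart, because g o and h o are separated by
more than the width of the shadows. *)
Let Y_distinct g h s t x y : g \in S -> h \in S -> g <> h ->
  Y g s x -> Y h t y ->
  gprod o x y <= m + 1 /\ gprod o x y < m - C - delta.
Proof.
move=> gS hS gh Yx Yy; have := Ssep gS hS gh.
have /andP[mg gm] := Sm gS; have /andP[mh hm] := Sm hS.
rewrite (mdist_gprod o) -!/(displ o _) => sep.
have xg := Y_shadow gS Yx; have yh := Y_shadow hS Yy.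
have d0 := delta0; have c0 := C0.
suff : gprod o x y <= gprod o (g o) (h o) + 2 * delta by split; lra.
rewrite leNgt; apply/negP => lt.
pose a := Num.min (gprod o x y) (m - C - delta).
have aC : gprod o (g o) (h o) + 2 * delta < a.
  by rewrite /a lt_min lt /=; lra.
have ax : a <= gprod o x y by rewrite /a ge_min lexx.
have am : a <= m - C - delta by rewrite /a ge_min lexx orbT.
have := gprod_trans3 hyp (x := g o) (y := x) (z := y) (w := h o) (a := a).
by rewrite (gprodC o (g o) x) => /(_ ltac:(lra) ax ltac:(lra) d0); lra.
Qed.

Let Y_gprod g h s t x y : g \in S -> h \in S -> (g, s) <> (h, t) ->
  Y g s x -> Y h t y -> gprod o x y <= C + 2 * delta + m + 1 /\ x <> y.
Proof.
move=> gS hS gsht Yx Yy; have d0 := delta0; have c0 := C0.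
have [gh|/eqP gh] := eqVneq g h; last first.
  have [le lt] := Y_distinct gS hS gh Yx Yy.
  split; first by lra.
  by move=> xy; move: lt; rewrite -xy gprodxx; have := Y_far gS Yx; lra.
rewrite -gh in gsht Yy.
have st : s <> t by move=> st; apply: gsht; rewrite st.
have le := Y_opp gS st Yx Yy; split.
  have := gprod_act_le o g (g^-1%g x) (g^-1%g y); rewrite !misomVK.
  by have /andP[] := Sm gS; lra.
move=> xy; move: le Yx; rewrite -xy gprodxx /Y /=.
have [hC _ _ _] := Setat gS.
have := gprod_lel o (g^-1%g x) (hs g s o); lra.
Qed.

Let Y_map g x : g \in S -> ~ Y g false x -> Y g true (pingpong_gen g x).
Proof.
have gE : g^-1%g (pingpong_gen g x) = eta g (g^-1%g x).
  by rewrite /pingpong_gen !misomM misomKV.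
move=> gS /negP; rewrite /Y /mkset gE gprod_actl -ltNge /hs => lt; lra.
Qed.

Let Y_closed g s : closed (Y g s).
Proof.
move=> x Yx /=; apply/ler_addgt0Pr => e e0.
have [y [Yy]] := Yx _ (nbhsx_ballx x e e0).
rewrite ballEmdist /= => xy; move: Yy; rewrite /Y /= => Yy.
have := gprod_lip o (g^-1%g y) (g^-1%g x) (hs g s o).
rewrite misom_opp_mdist metric_sym; lra.
Qed.

Let Y_disjoint g h s t : g \in S -> h \in S -> (g, s) <> (h, t) ->
  gromov_disjoint o (Y g s) (Y h t).
Proof.
move=> gS hS gsht; split.
  apply/disj_setPS => x.
  rewrite -(closure_id _).1 //; rewrite -(closure_id _).1 //.
  by move=> [Yx Yy]; have [_] := Y_gprod gS hS gsht Yx Yy.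
exists (C + 2 * delta + m + 2).
  by have := delta0; have := C0; have := mC; lra.
apply: (@le_lt_trans _ _ (C + 2 * delta + m + 1)%:E).
  apply: ge_ereal_sup => _ [[x y] /= [Yx Yy] <-].
  by rewrite lee_fin; have [] := Y_gprod gS hS gsht Yx Yy.
by rewrite lte_fin; lra.
Qed.

Let o_notin_Y g s : g \in S -> ~ Y g s o.
Proof. by move=> gS /(Y_far gS); rewrite mdistxx; have := mC; lra. Qed.

Lemma pingpong_gen_inj : {in S &, injective pingpong_gen}.
Proof.
move=> g h gS hS gh; apply: contrapT => ne.
have Yg := Y_map gS (o_notin_Y (s := false) gS).
have Yh := Y_map hS (o_notin_Y (s := false) hS).
rewrite gh in Yg.
have gsht : (g, true) <> (h, true) by case.
by have [_] := Y_gprod gS hS gsht Yg Yh.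
Qed.

(** Ping-pong sets are indexed by elements of Gamma while the Schottky condition
indexes them by generators; r recovers g from g (eta g) g^-1.  The complement
of the ping-pong sets contains the unit ball around o. *)
Lemma schottky_of_separated (Gamma : set (misom X)) (t A : R) (M : nat) :
  is_subgroup Gamma -> uniq S ->
  (forall g, g \in S -> Gamma g /\ Gamma (eta g)) ->
  (forall g, g \in S -> displ o (eta g) <= A) ->
  2 * (m + 1) + A < M%:R -> expR (t * M%:R) <= (size S)%:R ->
  exists H, [/\ is_subgroup H, H `<=` Gamma, schottky o H &
    (t%:E <= critical_exponent o H)%E].
Proof.
move=> sgG uS SG SA AM tM.
pose G := [seq pingpong_gen g | g <- S].
pose r k := nth 1%g S (index k G).
have rP k : k \in G -> r k \in S /\ pingpong_gen (r k) = k.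
  move=> kG; have iS : (index k G < size S)%N.
    by rewrite -(size_map pingpong_gen) index_mem.
  split; first exact: mem_nth.
  by rewrite -(nth_map _ 1%g)// nth_index.
pose Z k := Y (r k).
have rne k l (s t' : bool) : k \in G -> l \in G -> (k, s) <> (l, t') ->
    (r k, s) <> (r l, t').
  move=> /rP[_ kE] /rP[_ lE] ne [rkl st]; apply: ne.
  by rewrite -kE -lE rkl st.
have ZM k x : k \in G -> ~ Z k false x -> Z k true (k x).
  by move=> /rP[rS rE] nZ; rewrite -[in X in Z _ _ (X x)]rE; exact: Y_map.
have GP k : k \in G -> Gamma k.
  case/mapP => g /SG[Gg Gh] ->; apply: (subgroupM sgG).
    exact: (subgroupM sgG).
  exact: (subgroupV sgG).
exists (subgroup_gen [set` G]); split.
- exact: subgroup_gen_subgroup.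
- by apply: subgroup_gen_min => // k; exact: GP.
- exists [set` G], Z; split=> //.
  + by move=> k l s t' /= kG lG ne; apply: Y_disjoint;
      [exact: (rP _ kG).1|exact: (rP _ lG).1|exact: rne].
  + by move=> k kG _ [x nZ <-]; exact: ZM.
  + exists o; rewrite /interior /=; apply/nbhs_ballP; exists 1 => //= x.
    rewrite ballEmdist /= metric_sym => ox [k kG]; have [rS _] := rP _ kG.
    by case=> /(Y_far rS); have := mC; lra.
have HG k : k \in G -> subgroup_gen [set` G] k /\ displ o k <= 2 * (m + 1) + A.
  move=> kG; split; first exact: mem_subgroup_gen.
  case/mapP: kG => g gS ->; rewrite /pingpong_gen.
  have := displM_le o (g * eta g)%g g^-1%g; have := displM_le o g (eta g).
  rewrite displV; have /andP[_] := Sm gS; have := SA _ gS; lra.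
apply: (@critical_exponent_ge _ _ _ _ _ (size S) M) => //.
  rewrite -(ltr0n R); apply: le_lt_trans AM.
  have : 0 <= A.
    case: (S) tM SA => [|g s] tM SA.
      by have := expR_gt0 (t * M%:R); rewrite ltNge tM.
    by apply: le_trans (SA g _); [exact: displ_ge0|rewrite inE eqxx].
  by have := mC; have := delta0; have := C0; lra.
move=> k k0; exists (word_orbit o G k).
  split; last by rewrite size_word_orbit size_map.
  apply: (word_orbit_uniq (Y := Z)).
  - by rewrite map_inj_in_uniq//; exact: pingpong_gen_inj.
  - by move=> l s /rP[rS _]; exact: o_notin_Y.
  - move=> l l' s t' lG l'G ne x [Zx Zx'].
    have [_] := Y_gprod (rP _ lG).1 (rP _ l'G).1 (rne _ _ _ _ lG l'G ne) Zx Zx'.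
    by [].
  - exact: ZM.
move=> x xk; have [xM Hx] := word_orbitP (subgroup_gen_subgroup _) HG xk.
split=> //; apply: le_lt_trans xM _.
by rewrite natrM ltr_pM2l ?ltr0n.
Qed.

End Schottky.

(** * Thick annuli and separated subsets *)

Lemma limn_esup_gt (R : realType) (u : nat -> \bar R) (s : \bar R) (N : nat) :
  (s < limn_esup u)%E -> exists2 n, (N <= n)%N & (s < u n)%E.
Proof.
move=> su; apply: contrapT => nex; move: su; apply/negP; rewrite -leNgt.
apply: (@le_trans _ _ (ereal_sup (u @` [set n | (N <= n)%N]))).
  by apply: ereal_inf_lbound; exists [set n | (N <= n)%N] => //; exists N.
apply: ge_ereal_sup => _ [n /= Nn <-].
by rewrite leNgt; apply/negP => lt; apply: nex; exists n.
Qed.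

Lemma expR_beats (R : realType) (s s1 a b : R) : 0 <= s -> s < s1 ->
  0 <= a -> 0 <= b -> exists N : nat, forall n, (N <= n)%N ->
    b + n%:R * (a * expR (s * n%:R)) < expR (s1 * n%:R).
Proof.
move=> s0 ss1 a0 b0; pose e := (s1 - s) / 2.
have e0 : 0 < e by rewrite /e; lra.
have e20 : 0 < e ^+ 2 by rewrite exprn_gt0.
exists (Num.truncn ((a + b) / e ^+ 2)).+1 => n Nn.
have n1 : 1 <= n%:R :> R by rewrite ler1n (leq_trans _ Nn).
have nab : (a + b) < e ^+ 2 * n%:R.
  rewrite mulrC -ltr_pdivrMr//; apply: (lt_le_trans (truncnS_gt _)).
  by rewrite ler_nat.
have -> : expR (s1 * n%:R) = expR (s * n%:R) * expR (e * n%:R) ^+ 2.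
  by rewrite -expRM_natr -expRD; congr expR; rewrite /e; lra.
have x1 : 1 <= expR (s * n%:R).
  by rewrite -expR0 ler_expR mulr_ge0// ler0n.
have y1 : e * n%:R <= expR (e * n%:R).
  by apply: le_trans (expR_ge1Dx _); lra.
have en0 : 0 <= e * n%:R by rewrite mulr_ge0 ?ler0n// ltW.
set x := expR (s * n%:R) in x1 *; set y := expR (e * n%:R) in y1 *.
have yy : (e * n%:R) ^+ 2 <= y ^+ 2 by rewrite lerXn2r ?nnegrE ?expR_ge0.
have h1 : (a + b) * n%:R < (e * n%:R) ^+ 2.
  by rewrite exprMn [n%:R ^+ 2]expr2 mulrA ltr_pM2r//; lra.
have x0 : 0 < x by lra.
apply: (@le_lt_trans _ _ (x * ((a + b) * n%:R))).
  have xn : 1 <= x * n%:R by rewrite -[X in X <= _]mulr1 ler_pM.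
  move: (ler_wpM2l b0 xn); rewrite mulr1 => bxn.
  have -> : x * ((a + b) * n%:R) = n%:R * (a * x) + b * (x * n%:R).
    by rewrite mulrDl mulrDr (mulrCA x) (mulrCA x) (mulrCA n%:R) (mulrC n%:R x).
  by rewrite [leLHS]addrC lerD2l.
by rewrite ltr_pM2l//; apply: lt_le_trans h1 yy.
Qed.

Section Separated.
Context (T : choiceType) (R : realType) (f : T -> T -> R) (L : R).

Lemma separated_subseq (s : seq T) : (forall x, f x x <= L) ->
  (forall x y, f x y = f y x) ->
  exists t, [/\ uniq t, {subset t <= s},
    forall x y, x \in t -> y \in t -> x <> y -> L < f x y &
    forall x, x \in s -> exists2 y, y \in t & f y x <= L].
Proof.
move=> fxx fC; elim: s => [|x s [t [ut ts tsep tcov]]]; first by exists [::].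
have [[y yt yx]|nex] := pselect (exists2 y, y \in t & f y x <= L).
  exists t; split=> // [y' y't|z]; first by rewrite inE ts ?orbT.
  by rewrite inE => /orP[/eqP->|/tcov//]; exists y.
have far y : y \in t -> L < f x y.
  by move=> yt; rewrite ltNge fC; apply/negP => yx; apply: nex; exists y.
exists (x :: t); split=> /=.
- rewrite ut andbT; apply/negP => /far; rewrite ltNge.
  by rewrite fxx.
- by move=> y; rewrite !inE => /orP[->//|/ts ->]; rewrite orbT.
- move=> y z; rewrite !inE => /orP[/eqP->|yt] /orP[/eqP->|zt] // ne.
  + exact: far.
  + by rewrite fC; exact: far.
  + exact: tsep.
- move=> y; rewrite inE => /orP[/eqP->|/tcov[z zt zy]].
    by exists x; rewrite ?inE ?eqxx.
  by exists z; rewrite ?inE ?zt ?orbT.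
Qed.

End Separated.

Section Orbit.
Context (R : realType) (X : metricType R) (o : X).
Implicit Types (g h : misom X).
Context (Gamma : set (misom X)) (sgG : is_subgroup Gamma).
Context (lfG : forall r, finite_set [set g | Gamma g /\ displ o g <= r]).

Lemma finite_uniq_seq (T : choiceType) (A : set T) : finite_set A ->
  exists s : seq T, uniq s /\ forall x, x \in s <-> A x.
Proof.
move=> /finite_seqP[s ->]; exists (undup s); split; first exact: undup_uniq.
by move=> x; rewrite mem_undup.
Qed.

Lemma critical_exponent_gt (s : R) (N : nat) :
  (s%:E < critical_exponent o Gamma)%E ->
  exists n, (N <= n)%N /\ forall L : seq (misom X),
    (forall g, Gamma g -> displ o g < n%:R -> g \in L) ->
    expR (s * n%:R) < (size L)%:R.
Proof.
move=> /limn_esup_gt - /(_ (maxn 1 N))[n].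
rewrite geq_max => /andP[n0 Nn] un; exists n; split=> // L GL.
have nR : 0 < n%:R :> R by rewrite ltr0n.
set c := counting _ in un.
have cL : (c <= (size L)%:R%:E)%E.
  rewrite -(size_map (fun g : misom X => g o)); apply: counting_le_size.
  move=> x /= [xn [g Gg gx]]; move: xn.
  rewrite -gx ballEmdist /= metric_sym => gn.
  by apply/mapP; exists g => //; exact: GL.
have c0 : (0 <= c)%E by apply: (@counting_ge_size _ _ _ [::]).
have lc : ((s * n%:R)%:E < lne c)%E.
  by have := un; rewrite lte_pdivlMl// -EFinM mulrC.
have : ((s * n%:R)%:E < lne ((size L)%:R%:E))%E.
  apply: lt_le_trans lc _; rewrite lee_lne// in_itv /= ?c0 ?leey//.
  by rewrite lee_fin ler0n.
rewrite /lne; case: ifP => // /negbT; rewrite -ltNge => L0.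
by rewrite lte_fin => lt; rewrite -[ltRHS]lnK ?posrE// ltr_expR.
Qed.

(** Every ball of radius L centred on the orbit is a translate of the ball
around o, so at most size W elements of s fall within L of a given element
of t. *)
Lemma separated_size (L : R) (W s : seq (misom X)) : 0 <= L ->
  (forall g, Gamma g -> displ o g <= L -> g \in W) ->
  uniq s -> (forall g, g \in s -> Gamma g) ->
  exists t, [/\ uniq t, {subset t <= s},
    forall g h, g \in t -> h \in t -> g <> h -> L < mdist (g o) (h o) &
    (size s <= size t * size W)%N].
Proof.
move=> L0 GW us sG.
have [|g h|t [ut ts tsep tcov]] :=
  @separated_subseq _ R (fun g h : misom X => mdist (g o) (h o)) L s.
- by move=> g; rewrite mdistxx.
- exact: metric_sym.
exists t; split=> //.
rewrite -(size_allpairs (fun g h => (g * h)%g)).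
apply: uniq_leq_size => // g gs.
have [h ht hg] := tcov _ gs; apply/allpairsP; exists (h, h^-1 * g)%g => /=.
split=> //; last by rewrite mulVKg.
apply: GW; last by rewrite -displ_prod.
apply: (subgroupM sgG); last exact: sG.
by apply: (subgroupV sgG); apply: sG; exact: ts.
Qed.

(** Pigeonhole over the at most n annuli filling the ball of radius n; the inner
ball of radius m1 has a fixed number of elements, and the factor n is absorbed
in the gap between s and s1. *)
Lemma thick_annulus (s s1 a : R) (m1 : nat) : 0 <= s -> s < s1 -> 0 <= a ->
  (s1%:E < critical_exponent o Gamma)%E ->
  exists n m A, [/\ (m1 <= m < n)%N, uniq A,
    forall g, g \in A -> Gamma g /\ m%:R <= displ o g < m%:R + 1 &
    a * expR (s * n%:R) < (size A)%:R].
Proof.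
move=> s0 ss1 a0 sG.
have /choice[B BP] : forall n : nat, exists L : seq (misom X),
    uniq L /\ forall g, g \in L <-> Gamma g /\ displ o g < n%:R.
  move=> n; apply: finite_uniq_seq; apply: sub_finite_set (lfG n%:R).
  by move=> g /= [Gg gn]; split=> //; exact: ltW.
have [n0 n0P] := @expR_beats R s s1 a (size (B m1))%:R s0 ss1 a0 (ler0n _ _).
have [n [nn nB]] := critical_exponent_gt (maxn n0 m1) sG.
move: nn; rewrite geq_max => /andP[nn nm1].
have {}nB : expR (s1 * n%:R) < (size (B n))%:R.
  by apply: nB => g Gg gn; apply/(BP n).2.
pose Ann m := [seq g <- B m.+1 | m%:R <= displ o g].
apply: contrapT => nex.
have small m : (m1 <= m < n)%N -> (size (Ann m))%:R <= a * expR (s * n%:R).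
  move=> mn; rewrite leNgt; apply/negP => lt; apply: nex.
  exists n, m, (Ann m); split=> //; first by rewrite filter_uniq// (BP _).1.
  move=> g; rewrite mem_filter => /andP[mg /(BP _).2[Gg gm]].
  by rewrite mg /= natr1.
have growth k : (m1 + k <= n)%N ->
    (size (B (m1 + k)%N))%:R <= (size (B m1))%:R + k%:R * (a * expR (s * n%:R)).
  elim: k => [|k IHk] kn; first by rewrite addn0 mul0r addr0.
  have mk : (m1 <= m1 + k < n)%N by rewrite leq_addr -addnS.
  have {}IHk : (size (B (m1 + k)%N))%:R <=
      (size (B m1))%:R + k%:R * (a * expR (s * n%:R)).
    by apply: IHk; rewrite (leq_trans _ kn)// leq_add2l.
  have := small _ mk.
  have : ((size (B (m1 + k.+1)%N))%:R <=
      (size (B (m1 + k)%N))%:R + (size (Ann (m1 + k)%N))%:R :> R).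
    rewrite -natrD ler_nat -size_cat.
    apply: uniq_leq_size; first exact: (BP _).1.
    move=> g gB; rewrite mem_cat; apply/orP.
    have [lt|ge] := ltP (displ o g) (m1 + k)%:R.
      by left; apply/(BP _).2; split=> //; exact: (((BP _).2 g).1 gB).1.
    by right; rewrite mem_filter ge -addnS.
  move=> step Am; apply: le_trans step _.
  by rewrite -natr1 mulrDl mul1r addrA lerD.
have := growth (n - m1)%N; rewrite subnKC// leqnn => /(_ isT) le.
have := n0P _ nn.
have : (n - m1)%:R * (a * expR (s * n%:R)) <= n%:R * (a * expR (s * n%:R)).
  by rewrite ler_wpM2r ?ler_nat ?leq_subr// mulr_ge0// expR_ge0.
lra.
Qed.

End Orbit.

(** * Half of the critical exponent *)

Section Final.
Context (R : realType) (X : metricType R) (o : X).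
Context (Gamma : set (misom X)) (sgG : is_subgroup Gamma).

Lemma trivial_schottky : exists H : set (misom X),
  [/\ is_subgroup H, H `<=` Gamma, schottky o H &
    (0 <= critical_exponent o H)%E].
Proof.
exists (subgroup_gen set0); split.
- exact: subgroup_gen_subgroup.
- exact: subgroup_gen_min.
- exists set0, (fun _ _ => set0); split=> //.
  by exists o; rewrite bigcup_set0 setC0 interiorT.
apply: (@critical_exponent_ge _ _ _ _ 0 1 1) => //.
  by rewrite mul0r expR0.
move=> k k0; exists [:: o]; first by rewrite exp1n.
move=> x; rewrite inE => /eqP ->; rewrite mdistxx muln1 ltr0n; split=> //.
by exists 1%g => //; apply: subgroup1; exact: subgroup_gen_subgroup.
Qed.

Context (delta : R) (hyp : hyperbolic o delta) (delta0 : 0 <= delta).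
Context (tfG : torsion_free Gamma).
Context (lfG : forall r, finite_set [set g | Gamma g /\ displ o g <= r]).
Context (nofix : ~ fixes_boundary_point o Gamma).

Lemma unbounded_of_growth (s : R) : 0 < s ->
  (s%:E < critical_exponent o Gamma)%E ->
  forall B, exists2 g, Gamma g & B < displ o g.
Proof.
move=> s0 sG B; apply: contrapT => nex.
have [W [_ WP]] := finite_uniq_seq (lfG B).
have [n0 n0P] :=
  @expR_beats R 0 s 0 (size W)%:R (lexx _) s0 (lexx _) (ler0n _ _).
have [n [nn nW]] := critical_exponent_gt n0 sG.
have := n0P _ nn; rewrite mul0r mulr0 addr0 ltNge => /negP; apply; apply: ltW.
apply: nW => g Gg _; apply/WP; split=> //.
by rewrite leNgt; apply/negP => lt; apply: nex; exists g.
Qed.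

(** The separated subset S of the thick annulus gives generators of displacement
less than 2 n + c, where c only depends on the transverse pair. *)
Lemma schottky_half_exponent (s : R) : 0 <= s ->
  (s%:E < critical_exponent o Gamma)%E ->
  exists H : set (misom X), [/\ is_subgroup H, H `<=` Gamma, schottky o H &
    ((s / 2)%:E <= critical_exponent o H)%E].
Proof.
move=> s0 sG.
have [s1 ss1 s1G] : exists2 s1, s < s1 & (s1%:E < critical_exponent o Gamma)%E.
  case: (critical_exponent o Gamma) sG => [r||] // sr.
    rewrite lte_fin in sr; exists ((s + r) / 2); first by lra.
    by rewrite lte_fin; lra.
  by exists (s + 1); [lra|rewrite ltey].
have unbdd := unbounded_of_growth (le_lt_trans s0 ss1) s1G.
have [C [h Gh [C0 hP]]] :=
  exists_transverse_pair hyp delta0 sgG tfG lfG nofix unbdd.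
have /choice[b bP] := hP.
(* Points at distance more than L have shadows that are apart. *)
pose L := 2 * (C + 3 * delta + 1).
have L0 : 0 <= L by rewrite /L; have := delta0; lra.
have [W [_ WP]] := finite_uniq_seq (lfG L).
pose A := displ o (h true) + displ o (h false).
have hA c : displ o (h c) <= A.
  have := displ_ge0 o (h true); have := displ_ge0 o (h false).
  by rewrite /A; case: c; lra.
pose c := (Num.truncn A).+1; pose m1 := (Num.truncn (C + delta + 1)).+1.
(* Thinning an annulus to an L-separated subset costs the factor size W, and
   the term c in the displacement of the generators costs the exponential. *)
pose a := (size W)%:R * expR (s / 2 * c%:R).
have a0 : 0 <= a by rewrite mulr_ge0// expR_ge0.
have [n [m [Ann [/andP[m1m mn] uAnn AnnP Annsize]]]] :=
  thick_annulus lfG m1 s0 ss1 a0 s1G.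
have [|g gA|S [uS SAnn Ssep Ssize]] :=
  separated_size (o := o) sgG (W := W) L0 _ uAnn.
- by move=> g Gg gL; apply/WP.
- by have [] := AnnP _ gA.
apply: (@schottky_of_separated _ _ _ delta hyp delta0 C m%:R S
  (fun g => h (b g^-1%g)) C0 _ _ _ _ Gamma (s / 2) A (2 * n + c)) => //.
- apply/ltW/(lt_le_trans (truncnS_gt _)); by rewrite ler_nat.
- by move=> g /SAnn/AnnP[].
- by move=> g /SAnn/AnnP[Gg _].
- rewrite natrD natrM natr1.
  have : A < c%:R by exact: truncnS_gt.
  have : m.+1%:R <= n%:R :> R by rewrite ler_nat.
  lra.
have W0 : 0 < (size W)%:R :> R.
  rewrite ltr0n; have : (1%g : misom X) \in W.
    by apply/WP; split; [exact: subgroup1|rewrite displ1].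
  by case: (W).
rewrite -(ler_pM2r W0) -natrM.
have le : (size Ann)%:R <= (size S * size W)%:R :> R by rewrite ler_nat.
apply: le_trans le; apply: le_trans (ltW Annsize).
rewrite [leLHS]mulrC /a -[leRHS]mulrA -expRD ler_wpM2l//.
rewrite ler_expR natrD natrM; lra.
Qed.

End Final.

Local Open Scope ereal_scope.

Theorem mainTheorem6 (R : realType) (X : metricType R) (o : X)
  (Gamma : set (misom X)) :
  proper_metric X ->
  gromov_hyperbolic o ->
  compact_boundary o ->
  is_subgroup Gamma ->
  discrete_subset Gamma ->
  torsion_free Gamma ->
  ~ fixes_boundary_point o Gamma ->
  (2^-1)%:E * critical_exponent o Gamma <=
  ereal_sup [set critical_exponent o Gamma' | Gamma' in
    [set Gamma' : set (misom X) | [/\ is_subgroup Gamma', Gamma' `<=` Gamma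
                                   & schottky o Gamma']]].
Proof.
move=> properX [delta delta0 hyp] _ sgG dG tfG nofix.
have lfG r := discrete_locally_finite o properX r sgG dG.
set E := ereal_sup _; rewrite leNgt; apply/negP => lt.
have supE H : is_subgroup H -> H `<=` Gamma -> schottky o H ->
    critical_exponent o H <= E.
  by move=> sgH HG sH; apply: ereal_sup_ubound; exists H.
have E0 : 0 <= E.
  have [H [sgH HG sH H0]] := trivial_schottky o sgG.
  by apply: le_trans H0 _; exact: supE.
have [r Er rG] : exists2 r : R,
    E < r%:E & (2 * r)%:E < critical_exponent o Gamma.
  case: E E0 lt {supE} => [e||] //; last by move=> _; rewrite ltNge leey.
  case: (critical_exponent o Gamma) => [d||] _.
  - rewrite -EFinM lte_fin => ed; exists ((e + 2^-1 * d) / 2)%R.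
      by rewrite lte_fin; lra.
    by rewrite lte_fin; lra.
  - by move=> _; exists (e + 1)%R; rewrite ?lte_fin ?ltey//; lra.
  - by rewrite gt0_muleNy ?lte_fin ?invr_gt0// ltNge leNye.
have r0 : (0 <= 2 * r)%R.
  have : 0 < r%:E by exact: le_lt_trans Er.
  by rewrite lte_fin; lra.
have [H [sgH HG sH Hr]] :=
  schottky_half_exponent sgG hyp delta0 tfG lfG nofix r0 rG.
have := le_trans Hr (supE H sgH HG sH).
by rewrite leNgt mulrC mulKf// Er.
Qed.
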